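(* Let $0<c\le d$ be integers. Then there exist a Cohen–Macaulay local ring $(A,\mathfrak m)$ with infinite residue field and an $\mathfrak m$-primary ideal $I$ of $A$ such that $$d=\dim A,\qquad \mathrm e_1(I)=\mathrm e_0(I)-\ell_A(A/I)+1,\qquad\text{and}\qquad c=\ell_A(I^2/QI)$$ for some reduction $Q=(a_1,a_2,\dots,a_d)$ of $I$.
   Context: $\ell_A(\cdot)$ denotes length over $A$. For an $\mathfrak m$-primary ideal $I$ in a $d$-dimensional Cohen–Macaulay local ring $A$, the Hilbert coefficients $\mathrm e_i(I)$, $0\le i\le d$, are the integers such that $\ell_A(A/I^{n+1})=\mathrm e_0(I)\binom{n+d}{d}-\mathrm e_1(I)\binom{n+d-1}{d-1}+\cdots+(-1)^d\mathrm e_d(I)$ for all $n\gg 0$. An ideal $Q\subseteq I$ is a reduction of $I$ if $I^{n+1}=QI^n$ for some $n\ge 0$. *)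

(* Defs.v *)
From HB Require Import structures.
From mathcomp Require Import all_boot all_order all_algebra.
From mathcomp Require Import ring_quotient.
From mathcomp Require Import boolp classical_sets functions cardinality.

Set Implicit Arguments.
Unset Strict Implicit.
Unset Printing Implicit Defensive.

Import Order.TTheory GRing.Theory Num.Theory.
Local Open Scope classical_set_scope.
Local Open Scope ring_scope.

Section CommutativeAlgebra.
Variable A : comNzRingType.
Implicit Types (I J P Q m : set A) (s : seq A) (n : nat).

(* Ideals, possibly improper, are the A-submodules of A (that is, of A^o). *)
Definition ideal I : Prop := submod_closed ([in I] : {pred A^o}).

(* The properness of I is part of the library predicate [idealr_closed]. *)
Definition proper_idl I : Prop := idealr_closed [in I].

Definition prime_ideal P : Prop := proper_idl P /\ prime_idealr_closed [in P].

Definition maximal_ideal m : Prop :=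
  proper_idl m /\ forall J, proper_idl J -> m `<=` J -> J = m.

Definition generated s : set A :=
  [set x | exists r : 'I_(size s) -> A, x = \sum_(i < size s) r i * s`_i].

Definition ideal_mul I J : set A :=
  [set x | exists n (u v : 'I_n -> A),
     [/\ forall i, I (u i), forall i, J (v i) & x = \sum_(i < n) u i * v i]].

Definition ideal_exp I n : set A := iter n (ideal_mul I) setT.

Definition radical I : set A := [set x | exists n, I (x ^+ n)].

Definition primary_ideal I : Prop :=
  proper_idl I /\
  forall x y, I (x * y) -> I x \/ exists n, I (y ^+ n).

Definition primary_to m I : Prop := primary_ideal I /\ radical I = m.

Definition noetherian : Prop :=
  forall I, ideal I -> exists s, I = generated s.

Definition local_ring m : Prop :=
  maximal_ideal m /\ forall m', maximal_ideal m' -> m' = m.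

(* The elements of A/m, as cosets. *)
Definition cosets m : set (set A) :=
  range (fun a => [set b | m (b - a)]).

(* A strict chain K 0 < ... < K n all of whose n + 1 terms satisfy C. *)
Definition strict_chain (C : set A -> Prop) (K : nat -> set A) n : Prop :=
  (forall i, (i <= n)%N -> C (K i)) /\
  (forall i, (i < n)%N -> K i `<` K i.+1).

Definition krull_dim n : Prop :=
  (exists K, strict_chain prime_ideal K n) /\
  (forall K k, strict_chain prime_ideal K k -> (k <= n)%N).

(* The A-submodules of I/J are the K/J for the ideals K with J <= K <= I. *)
Definition submodule_chain I J n : Prop :=
  exists K, [/\ strict_chain ideal K n, K 0%N = J & K n = I].

(* I/J has finite length n over A. *)
Definition quot_length I J n : Prop :=
  submodule_chain I J n /\ forall k, submodule_chain I J k -> (k <= n)%N.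

Definition regular_sequence s : Prop :=
  (forall i, (i < size s)%N ->
     forall x, generated (take i s) (s`_i * x) -> generated (take i s) x) /\
  ~ generated s 1.

Definition regular_in m s : Prop :=
  (forall x, x \in s -> m x) /\ regular_sequence s.

Definition depth m n : Prop :=
  (exists s, regular_in m s /\ size s = n) /\
  (forall s, regular_in m s -> (size s <= n)%N).

Definition CohenMacaulay_local m : Prop :=
  [/\ noetherian, local_ring m & exists n, krull_dim n /\ depth m n].

(* Only e 0, ..., e d are constrained. *)
Definition hilbert_coefficients (d : nat) I (e : nat -> int) : Prop :=
  exists N : nat, forall n : nat, (N <= n)%N ->
    exists2 l : nat, quot_length setT (ideal_exp I n.+1) l &
      l%:Z = \sum_(i < d.+1)
               (-1) ^+ i * e i * ('C(n + d - i, d - i)%N)%:Z.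

Definition reduction Q I : Prop :=
  [/\ ideal Q, Q `<=` I &
      exists n, ideal_exp I n.+1 = ideal_mul Q (ideal_exp I n)].

End CommutativeAlgebra.
Arguments krull_dim : clear implicits.
Arguments noetherian : clear implicits.

(* Main.v *)
Require Import Defs.
From HB Require Import structures.
From mathcomp Require Import all_boot all_order all_algebra.
From mathcomp Require Import fraction mpoly ring zify.
From mathcomp Require Import boolp classical_sets functions cardinality.

(** Let [R] be the local ring at the origin of affine [d]-space over the
  rationals, with maximal ideal [n] generated by the variables [z 0, .., z d.-1],
  and let [A] be the free [R]-algebra with basis [1, g 0, .., g c.-1, y], in which
  [g i * g i = z i * y] and the other products of two vectors among [y] and the
  [g i] vanish.  The ideal is [I = n + (g 0, .., g c.-1) + n * y], and [Q] is
  generated by the variables.  As [g i * g i] has a coefficient in [n], [I] is an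
  ideal and [y] is not in it, so that [A/I] has length 2.  Componentwise, along
  [1], the [g i] and [y],

    [I ^ k = n ^ k + n ^ k.-1 * g + (n ^ k + n ^ k.-2 * (z 0, .., z c.-1)) * y]

  for [k >= 2], and [Q * I] is obtained from [I ^ 2] by removing
  [(z 0, .., z c.-1) * y]: the quotient has length [c].  Also [I ^ 3 = Q * I ^ 2].
  The Sally module of [I] is thus, up to a shift, the ideal generated by [c]
  variables in a polynomial ring, of rank one.  The length of [A/I ^ k.+1] counts
  monomials: those in the component of [y] which [I ^ k.+1] misses are the
  monomials of degree less than [k] and those of degree [k] in the last [d - c]
  variables.  This gives [e 0 = c + 2], [e 1 = c + 1] and, when [c < d], a single
  further nonzero coefficient, of index [c + 1].

  All ideals of [R] involved are generated by monomials.  A fraction belongs to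
  such an ideal when the monomials of its numerator do, whatever the
  representation ([monideal_msupp]), and this reduces products, quotients and
  primality to combinatorics of exponents.  Lengths are dimensions over the
  coefficient field, computed with bases of monomials ([quot_length_basis]).

  [A] is Noetherian by the Hilbert basis theorem, here deduced from Dickson's
  lemma ([mpoly_noetherian]).  It is free over [R], so that the variables, which
  form a regular sequence in [R], also form one in [A], and they define a chain of
  [d.+1] primes.  The upper bound [d] on both the dimension and the depth comes
  from one elementary fact ([chain_collapse]): [d.+1] elements of [A] satisfy an
  algebraic relation with coefficients in the field, by a count of dimensions, and
  a relation cannot hold between elements [x i] regular modulo [J i] and belonging
  to [J i.+1], for a chain of ideals [J 0, .., J d.+1] with [J d.+1] proper. *)

Set Implicit Arguments.
Unset Strict Implicit.
Unset Printing Implicit Defensive.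

Import Order.TTheory GRing.Theory Num.Theory.
Local Open Scope classical_set_scope.
Local Open Scope ring_scope.

(** * Ideals as sets *)

Section Ideals.
Variable A : comNzRingType.
Implicit Types (I J K P m : set A) (s : seq A).

Lemma idealP I :
  ideal I <-> [/\ I 0, forall x y, I x -> I y -> I (x + y) &
                  forall a x, I x -> I (a * x)].
Proof.
split=> [[I0 Ilin]|[I0 ID IM]].
  have I0' : I 0 by move: I0; rewrite unfold_in /= in_setE.
  have lin a u v : I u -> I v -> I (a * u + v).
    move=> Iu Iv; have := Ilin a u v; rewrite !unfold_in /= !in_setE.
    exact.
  split=> // [x y Ix Iy|a x Ix]; first by rewrite -[x]mul1r; apply: lin.
  by rewrite -[_ * _]addr0; apply: lin.
split; first by rewrite unfold_in /= in_setE.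
move=> a u v; rewrite !unfold_in /= !in_setE => Iu Iv.
by apply: ID => //; apply: IM.
Qed.

Lemma proper_idlP I : proper_idl I <-> ideal I /\ ~ I 1.
Proof.
split=> [[I0 I1 Ilin]|[/idealP[I0 ID IM] I1]].
  have lin a u v : I u -> I v -> I (a * u + v).
    by have := Ilin a u v; rewrite !in_setE; apply.
  rewrite in_setE in I0; move: I1; rewrite notin_setE => I1.
  split=> //; apply/idealP; split=> // [x y Ix Iy|a x Ix].
    by rewrite -[x]mul1r; apply: lin.
  by rewrite -[_ * _]addr0; apply: lin.
split; rewrite ?in_setE ?notin_setE// => a u v.
by rewrite !in_setE => Iu Iv; apply: ID => //; apply: IM.
Qed.

Lemma prime_idealP P :
  prime_ideal P <->
  [/\ ideal P, ~ P 1 & forall x y, P (x * y) -> P x \/ P y].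
Proof.
split=> [[/proper_idlP[iP P1] Pp]|[iP P1 Pp]].
  split=> // x y Pxy; have := Pp x y; rewrite !in_setE => /(_ Pxy)/orP.
  by rewrite !in_setE.
split; first exact/proper_idlP.
by move=> x y; rewrite in_setE => /Pp[] xP; apply/orP; [left|right];
  rewrite in_setE.
Qed.

Lemma ideal0 I : ideal I -> I 0. Proof. by case/idealP. Qed.

Lemma idealD I x y : ideal I -> I x -> I y -> I (x + y).
Proof. by case/idealP=> _ + _; apply. Qed.

Lemma idealMl I a x : ideal I -> I x -> I (a * x).
Proof. by case/idealP=> _ _; apply. Qed.

Lemma idealMr I a x : ideal I -> I x -> I (x * a).
Proof. by rewrite mulrC; apply: idealMl. Qed.

Lemma idealN I x : ideal I -> I x -> I (- x).
Proof. by rewrite -mulN1r; apply: idealMl. Qed.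

Lemma idealB I x y : ideal I -> I x -> I y -> I (x - y).
Proof. by move=> iI Ix Iy; apply: idealD => //; apply: idealN. Qed.

Lemma ideal_sum I (T : Type) (r : seq T) (P : pred T) (F : T -> A) :
  ideal I -> (forall i, P i -> I (F i)) -> I (\sum_(i <- r | P i) F i).
Proof.
move=> iI IF; apply: (big_ind I) => //; first exact: ideal0.
by move=> x y; apply: idealD.
Qed.

Lemma ideal_unitM I u v x : ideal I -> u * v = 1 -> I (u * x) -> I x.
Proof.
by move=> iI uv1 /(idealMl v iI); rewrite mulrA [v * u]mulrC uv1 mul1r.
Qed.

Lemma generated_ideal s : ideal (generated s).
Proof.
apply/idealP; split=> [|x y [r ->] [t ->]|a x [r ->]].
- by exists (fun=> 0); rewrite big1// => i _; rewrite mul0r.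
- exists (fun i => r i + t i); rewrite -big_split /=.
  by apply: eq_bigr => i _; rewrite mulrDl.
exists (fun i => a * r i); rewrite mulr_sumr.
by apply: eq_bigr => i _; rewrite mulrA.
Qed.

Lemma mem_generated s x : x \in s -> generated s x.
Proof.
move=> xs; have lt_ix : (index x s < size s)%N by rewrite index_mem.
exists (fun i => (i == Ordinal lt_ix)%:R).
rewrite (bigD1 (Ordinal lt_ix))//= eqxx mul1r nth_index// big1 ?addr0//.
by move=> i /negbTE ->; rewrite mul0r.
Qed.

Lemma generated_min s J :
  ideal J -> (forall x, x \in s -> J x) -> generated s `<=` J.
Proof.
move=> iJ sJ _ [r ->]; apply: ideal_sum => // i _.
by apply: idealMl => //; apply/sJ/mem_nth.
Qed.

Lemma mem_ideal_mul I J u v : I u -> J v -> ideal_mul I J (u * v).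
Proof.
move=> Iu Jv; exists 1%N, (fun=> u), (fun=> v); split=> //.
by rewrite big_ord1.
Qed.

Lemma ideal_mul_min I J K :
  ideal K -> (forall u v, I u -> J v -> K (u * v)) -> ideal_mul I J `<=` K.
Proof.
move=> iK IJK _ [n [u [v [Iu Jv ->]]]].
by apply: ideal_sum => // i _; apply: IJK.
Qed.

Lemma ideal_mul_ideal I J : ideal I -> ideal (ideal_mul I J).
Proof.
move=> iI; apply/idealP; split.
- exists 0%N, (fun=> 0), (fun=> 0); split; try by case.
  by rewrite big_ord0.
- move=> _ _ [n [u [v [Iu Jv ->]]]] [k [u' [v' [Iu' Jv' ->]]]].
  pose glue (f : 'I_n -> A) g (i : 'I_(n + k)) :=
    match fintype.split i with inl j => f j | inr j => g j end.
  have glueP (X : set A) f g : (forall i, X (f i)) -> (forall i, X (g i)) ->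
      forall i, X (glue f g i).
    by move=> Xf Xg i; rewrite /glue; case: splitP.
  have gluel f g (i : 'I_n) : glue f g (lshift k i) = f i.
    by rewrite /glue; case: (split_ordP (lshift k i)) => [j /lshift_inj ->|j /eqP];
      rewrite // eq_lrshift.
  have gluer f g (i : 'I_k) : glue f g (rshift n i) = g i.
    by rewrite /glue; case: (split_ordP (rshift n i)) => [j /eqP|j /rshift_inj ->];
      rewrite // eq_rlshift.
  exists (n + k)%N, (glue u u'), (glue v v'); split; try exact: glueP.
  rewrite big_split_ord /=; congr (_ + _); apply: eq_bigr => i _.
    by rewrite !gluel.
  by rewrite !gluer.
move=> a _ [n [u [v [Iu Jv ->]]]].
exists n, (fun i => a * u i), v; split=> // [i|]; first exact: idealMl.
by rewrite mulr_sumr; apply: eq_bigr => i _; rewrite mulrA.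
Qed.

Lemma local_ring_units m :
  ideal m -> ~ m 1 -> (forall x, ~ m x -> exists y, x * y = 1) ->
  local_ring m.
Proof.
move=> im m1 mU.
have sub J : proper_idl J -> J `<=` m.
  move=> /proper_idlP[iJ J1] x Jx; apply: contrapT => /mU[y xy1].
  by apply: J1; rewrite -xy1; apply: idealMr.
have pm : proper_idl m by apply/proper_idlP.
split; first by split=> // J pJ mJ; apply/seteqP; split=> //; apply: sub.
by move=> m' [pm' max]; rewrite (max m)//; apply: sub.
Qed.

End Ideals.

(** * Lengths as dimensions over a coefficient field *)

Section Length.
Variables (A : comNzRingType) (F : fieldType) (k : {rmorphism F -> A}).
Implicit Types (I J m : set A).

Definition spans_mod J I (T : finType) (D : {pred T}) (e : T -> A) :=
  forall x, I x -> exists a : T -> F, J (x - \sum_(i in D) k (a i) * e i).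

Definition free_mod J (T : finType) (D : {pred T}) (e : T -> A) :=
  forall a : T -> F, J (\sum_(i in D) k (a i) * e i) ->
    forall i, i \in D -> a i = 0.

(** Steinitz: a matrix with more rows than columns has a left kernel. *)
Lemma free_le_span J I (T T' : finType) (D : {pred T}) (D' : {pred T'}) e e' :
  ideal J -> (forall i, i \in D -> I (e i)) ->
  free_mod J D e -> spans_mod J I D' e' -> (#|D| <= #|D'|)%N.
Proof.
move=> iJ Ie fe se; rewrite leqNgt; apply/negP => ltD.
have /choice[a aP] (i : 'I_#|D|) : exists a : T' -> F,
    J (e (enum_val i) - \sum_(j in D') k (a j) * e' j).
  by apply: se; apply/Ie/enum_valP.
pose M := \matrix_(i < #|D|, j < #|D'|) a i (enum_val j).
have: kermx M != 0.
  by rewrite kermx_eq0 -row_leq_rank -ltnNge (leq_ltn_trans (rank_leq_col M)).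
case/rowV0Pn=> v /sub_kermxP vM0 /eqP; apply.
have := fe (fun t => if [pick i | enum_val i == t] is Some i
                     then v 0 i else 0).
have b_val i : (if [pick j | enum_val j == enum_val i :> T] is Some j
     then v 0 j else 0) = v 0 i.
  case: pickP => [j /eqP/enum_val_inj -> //|/(_ i)]; by rewrite eqxx.
rewrite big_enum_val /= => H; apply/rowP => i; rewrite mxE -[LHS]b_val.
apply: H; last exact: enum_valP.
under eq_bigr do rewrite b_val.
have -> : \sum_(i < #|D|) k (v 0 i) * e (enum_val i) =
    \sum_(i < #|D|) k (v 0 i) *
      (e (enum_val i) - \sum_(j in D') k (a i j) * e' j).
  apply/eqP; rewrite -subr_eq0 -sumrB; apply/eqP.
  transitivity (\sum_(j in D') k (\sum_i v 0 i * a i j) * e' j).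
    under eq_bigr => l _ do rewrite -mulrBr opprB addrC subrK mulr_sumr.
    rewrite exchange_big /=; apply: eq_bigr => j _.
    rewrite rmorph_sum mulr_suml; apply: eq_bigr => l _.
    by rewrite rmorphM mulrA.
  rewrite big_enum_val big1// => j _.
  have := congr1 (fun N : 'rV_ _ => N 0 j) vM0; rewrite !mxE.
  under eq_bigr do rewrite mxE; move=> ->.
  by rewrite rmorph0 mul0r.
by apply: ideal_sum => // l _; apply: idealMl.
Qed.

(** Elements picked in the successive steps of a strict chain of ideals are
  linearly independent modulo the bottom: only the last nonzero coefficient
  of a relation matters. *)
Lemma free_chain (K : nat -> set A) n (x : 'I_n -> A) :
  (forall i, (i <= n)%N -> ideal (K i)) ->
  (forall i, (i < n)%N -> K i `<=` K i.+1) ->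
  (forall i : 'I_n, K i.+1 (x i) /\ ~ K i (x i)) ->
  free_mod (K 0%N) [pred _ : 'I_n | true] x.
Proof.
move=> iK KS Kx a; rewrite (eq_bigl xpredT)// => Ksum.
have Kle i j : (i <= j <= n)%N -> K i `<=` K j.
  case/andP=> le_ij; rewrite -(subnKC le_ij); elim: (j - i)%N => [|t IH].
    by move=> _ y; rewrite addn0.
  rewrite addnS => lt_n; apply: subset_trans (IH (ltnW lt_n)) _.
  exact: KS.
have main t : (t <= n)%N -> forall i : 'I_n, (n - t <= i)%N -> a i = 0.
  elim: t => [|t IH] ltn i; first by rewrite subn0 leqNgt ltn_ord.
  have SnS : (n - t.+1).+1 = (n - t)%N by rewrite -subSn ?subSS.
  rewrite leq_eqVlt => /predU1P[Ei|]; last first.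
    by rewrite SnS; apply: (IH (ltnW ltn)).
  apply: contrapT => /eqP ai0; case: (Kx i) => Kxi; apply.
  have iKi := iK i (ltnW (ltn_ord i)).
  apply: (@ideal_unitM _ _ (k (a i)) (k (a i)^-1)) => //.
    by rewrite -rmorphM divff// rmorph1.
  have KsumI : K i (\sum_(i < n) k (a i) * x i).
    by apply: (Kle 0%N) Ksum; rewrite /= ltnW.
  rewrite (bigD1 i)//= in KsumI.
  rewrite -[k _ * _](addrK (\sum_(j < n | j != i) k (a j) * x j)).
  apply: idealB => //; apply: ideal_sum => // j neji.
  have [ltij|] := ltnP i j.
    rewrite (IH (ltnW ltn)) ?rmorph0 ?mul0r//; first exact: ideal0.
    by rewrite -SnS Ei.
  rewrite leq_eqVlt val_eqE (negbTE neji)/= => ltji.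
  apply: idealMl => //; case: (Kx j) => Kxj _; apply: Kle Kxj.
  by rewrite ltji /= ltnW.
by move=> i _; apply: (main n); rewrite ?subnn.
Qed.

Lemma length_le_span J I (T : finType) (D : {pred T}) e n :
  spans_mod J I D e -> submodule_chain I J n -> (n <= #|D|)%N.
Proof.
move=> se [K [[iK KS] K0 Kn]].
have /choice[x xP] (i : 'I_n) : exists x, K i.+1 x /\ ~ K i x.
  by have [_ /existsNP[x /not_implyP[? ?]]] := KS i (ltn_ord i); exists x.
rewrite -[X in (X <= _)%N]card_ord.
have KI i : (i <= n)%N -> K i `<=` I.
  rewrite -Kn => lein; rewrite -[in K n](subnKC lein).
  have : (i + (n - i) <= n)%N by rewrite subnKC.
  elim: (n - i)%N => [|t IH]; first by move=> _ y; rewrite addn0.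
  rewrite addnS => lt_n; apply: subset_trans (IH (ltnW lt_n)) _.
  by case: (KS _ lt_n).
apply: (@free_le_span J I _ _ [pred _ | true] D x e _ _ _ se).
- by rewrite -K0; apply: iK.
- by move=> i _; apply: (KI i.+1) => //; case: (xP i).
by rewrite -K0; apply: free_chain => // i lt_in; case: (KS i lt_in).
Qed.

(** Multiplying an element outside [J] by as many elements of [m] as possible
  without entering [J] leads to the socle of [A/J]. *)
Lemma socle_multiple J m N x :
  ~ J x ->
  (forall s, size s = N -> (forall y, y \in s -> m y) ->
     J (\prod_(y <- s) y * x)) ->
  exists a, ~ J (a * x) /\ forall y, m y -> J (y * (a * x)).
Proof.
elim: N x => [|N IH] x Jx Jprod.
  by case: Jx; have := Jprod [::] erefl; rewrite big_nil mul1r; apply.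
have [socx|] := pselect (forall y, m y -> J (y * x)).
  by exists 1; rewrite mul1r.
case/existsNP=> y /not_implyP[my Jyx].
have [s ss sm|a [Jax soca]] := IH _ Jyx.
  have -> : \prod_(z <- s) z * (y * x) = \prod_(z <- rcons s y) z * x.
    by rewrite -cats1 big_cat big_seq1 mulrA.
  apply: Jprod => [|z]; first by rewrite size_rcons ss.
  by rewrite mem_rcons inE => /predU1P[->//|/sm].
by exists (a * y); rewrite -mulrA.
Qed.

Definition adjoin J x : set A := [set y | exists t, J (y - k t * x)].

Lemma adjoin_ideal J m x : ideal J -> (forall a, exists t, m (a - k t)) ->
  (forall y, m y -> J (y * x)) -> ideal (adjoin J x).
Proof.
move=> iJ mk socx; apply/idealP; split=> [|y z [t Jy] [u Jz]|a y [t Jy]].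
- by exists 0; rewrite rmorph0 mul0r subr0; apply: ideal0.
- exists (t + u); rewrite rmorphD mulrDl opprD addrACA.
  exact: idealD.
have [u mu] := mk a; exists (t * u).
have -> : a * y - k (t * u) * x =
    a * (y - k t * x) + k t * ((a - k u) * x) by rewrite rmorphM; ring.
by apply: idealD => //; apply: idealMl => //; apply: socx.
Qed.

(** Over a local ring whose residue field is the coefficient field [F], a
  basis of [I/J] over [F] computes its length: as [I/J] is killed by a power of
  [m], one-dimensional submodules can be split off one at a time. *)
Lemma quot_length_basis J I m (T : finType) (D : {pred T}) e N :
  ideal J -> ideal I -> J `<=` I ->
  (forall a, exists t, m (a - k t)) ->
  (forall s x, size s = N -> (forall y, y \in s -> m y) -> I x ->
     J (\prod_(y <- s) y * x)) ->
  (forall i, i \in D -> I (e i)) -> free_mod J D e -> spans_mod J I D e ->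
  quot_length I J #|D|.
Proof.
move=> iJ iI JI mk nilm De fe se.
split; last by move=> n; apply: length_le_span se.
(* Adjoin a socle element at each step: the dimension shows that [I] cannot be
  reached before step [#|D|]. *)
pose good K x := [/\ I x, ~ K x & forall y, m y -> K (y * x)].
pose pick K := xget 0 (good K).
pose K i := iter i (fun K => adjoin K (pick K)) J.
have pickP L : ideal L -> J `<=` L -> ~ (I `<=` L) -> good L (pick L).
  move=> iL JL /existsNP[y /not_implyP[Iy Ly]].
  have [s ss sm|a [Lay soca]] := @socle_multiple L m N y Ly.
    exact/JL/nilm.
  apply: (@xgetPex _ 0 (good L)); exists (a * y); split=> //.
  exact: idealMl.
have nextP i : (i < #|D|)%N -> ideal (K i) -> J `<=` K i ->
    spans_mod J (K i) [pred _ : 'I_i | true] (fun j => pick (K j)) ->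
    good (K i) (pick (K i)).
  move=> lti iK JK sK; apply: pickP => // IK.
  have := @free_le_span J I _ _ D [pred _ : 'I_i | true] e _ iJ De fe.
  move=> /(_ (fun j => pick (K j)))/(_ (fun x Ix => sK x (IK x Ix))).
  by rewrite card_ord leqNgt lti.
have inv i : (i <= #|D|)%N ->
    [/\ ideal (K i), J `<=` K i, K i `<=` I &
        spans_mod J (K i) [pred _ : 'I_i | true] (fun j => pick (K j))].
  elim: i => [|i IH] lti.
    split=> // x Jx; exists (fun=> 0); rewrite big1 ?subr0// => j _.
    by rewrite rmorph0 mul0r.
  have [iK JK KI sK] := IH (ltnW lti).
  have [Ip Kp socp] := nextP _ lti iK JK sK.
  split=> //=; first exact: adjoin_ideal.
  - by move=> x Jx; exists 0; rewrite rmorph0 mul0r subr0; apply: JK.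
  - move=> x [t /KI Ix]; rewrite -[x](subrK (k t * pick (K i))).
    by apply: idealD => //; apply: idealMl.
  move=> x [t /sK[a Ja]].
  exists (fun j : 'I_i.+1 => if unlift ord_max j is Some l then a l else t).
  rewrite big_ord_recr /= unlift_none opprD addrA addrAC.
  congr (J (_ - _)) : Ja; apply: eq_bigr => l _; congr (k _ * _).
  have -> : widen_ord (leqnSn i) l = lift ord_max l.
    by apply: val_inj; rewrite /= /bump leqNgt ltn_ord.
  by rewrite liftK.
have strict : strict_chain (@ideal A) K #|D|.
  split=> [i /inv[]//|i lti]; have [iK JK KI sK] := inv i (ltnW lti).
  have [Ip Kp socp] := nextP _ lti iK JK sK.
  split=> [x Kx|]; first by exists 0; rewrite rmorph0 mul0r subr0.
  move=> /(_ (pick (K i))) KS; apply/Kp/KS; exists 1.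
  by rewrite rmorph1 mul1r subrr; apply: ideal0.
have [_ _ KI _] := inv _ (leqnn _).
exists K; split=> //; apply: contrapT => KneI.
pose K' i := if (i <= #|D|)%N then K i else I.
suff /(length_le_span se) : submodule_chain I J #|D|.+1 by rewrite ltnn.
exists K'; split; rewrite /K' ?ltnn//; split=> [i|i]; case: (strict) => iK KS.
  by case: ifP => // leiD _; apply: iK.
rewrite ltnS => lei; rewrite leq_eqVlt in lei; case/predU1P: lei => [->|lti].
  rewrite leqnn ltnn; split=> // IK.
  by apply: KneI; apply/seteqP.
by rewrite (ltnW lti) lti; apply: KS.
Qed.

End Length.

(** * Noetherianity *)

Lemma nondecreasing_subseq (f : nat -> nat) :
  exists h : nat -> nat, {homo h : i j / (i < j)%N} /\
    {homo (f \o h) : i j / (i <= j)%N}.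
Proof.
have /choice[g gP] (n : nat) :
    exists p, (n <= p)%N /\ forall q, (n <= q)%N -> (f p <= f q)%N.
  pose P v := `[< exists2 p, (n <= p)%N & f p = v >].
  have exP : exists v, P v by exists (f n); apply/asboolP; exists n.
  case: (ex_minnP exP) => v /asboolP[p le_np <-] minv.
  by exists p; split=> // q le_nq; apply/minv/asboolP; exists q.
pose h := fix h i := if i is j.+1 then g (h j).+1 else g 0%N.
have hS i : (h i < h i.+1)%N by have [] := gP (h i).+1.
have hmono : {homo h : i j / (i < j)%N}.
  by apply: homo_ltn => // y x z; apply: ltn_trans.
exists h; split=> //; apply: homo_leq => // [y x z|i]; first exact: leq_trans.
case: i => [|i]; first exact: (gP 0%N).2.
by apply: (gP (h i).+1).2; apply: ltn_trans (hS i) (hS i.+1).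
Qed.

Lemma nondecreasing_mnm_subseq n (f : nat -> 'X_{1..n}) :
  exists h : nat -> nat, {homo h : i j / (i < j)%N} /\
    forall i j, (i <= j)%N -> (f (h i) <= f (h j))%MM.
Proof.
have main k : (k <= n)%N -> exists h : nat -> nat,
    {homo h : i j / (i < j)%N} /\ forall l : 'I_n, (l < k)%N ->
      {homo (fun i => f (h i) l) : i j / (i <= j)%N}.
  elim: k => [|k IH] ltkn; first by exists id; split.
  have [h [hmono hk]] := IH (ltnW ltkn).
  have [g [gmono gk]] :=
    nondecreasing_subseq (fun i => f (h i) (Ordinal ltkn)).
  exists (h \o g); split=> [i j /gmono/hmono//|l].
  rewrite ltnS leq_eqVlt => /predU1P[lk|lk] i j leij.
    by rewrite (_ : l = Ordinal ltkn); [apply: gk | apply: val_inj].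
  apply: (hk l lk); move: leij; rewrite leq_eqVlt => /predU1P[->//|/gmono].
  exact: ltnW.
have [h [hmono hn]] := main n (leqnn n).
by exists h; split=> // i j leij; apply/mnm_lepP => l; apply: hn.
Qed.

(** Dickson's lemma: otherwise one could pick an infinite sequence of
  monomials none of which divides a later one. *)
Lemma dickson n (L : set 'X_{1..n}) :
  exists s : seq 'X_{1..n}, (forall m, m \in s -> L m) /\
    forall m, L m -> exists2 m', m' \in s & (m' <= m)%MM.
Proof.
apply: contrapT => noL.
have /choice[g gP] (s : seq 'X_{1..n}) : exists m, (forall m', m' \in s -> L m') ->
    L m /\ forall m', m' \in s -> ~~ (m' <= m)%MM.
  have [sL|nsL] := pselect (forall m', m' \in s -> L m'); last first.
    by exists 0%MM => /nsL.
  apply: contrapT => nom; apply: noL; exists s; split=> // m Lm.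
  apply: contrapT => no_m'; apply: nom; exists m => _; split=> // m' m's.
  by apply/negP => lem'; apply: no_m'; exists m'.
pose s i := iter i (fun s => g s :: s) [::].
have sL i m : m \in s i -> L m.
  elim: i m => // i IH m; rewrite inE => /predU1P[->|/IH//].
  by case: (gP (s i) IH).
have gs i j : (i < j)%N -> g (s i) \in s j.
  elim: j => // j IH; rewrite ltnS leq_eqVlt => /predU1P[->|/IH] /=.
    by rewrite mem_head.
  by rewrite inE orbC => ->.
have [h [hmono hle]] := nondecreasing_mnm_subseq (fun i => g (s i)).
have [_ /(_ (g (s (h 0%N))))] := gP (s (h 1%N)) (sL _).
by rewrite hle// => /(_ (gs _ _ (hmono 0%N 1%N isT))).
Qed.

(** Division by polynomials whose leading monomials generate those of the
  ideal leaves no remainder. *)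
Lemma mpoly_noetherian (F : fieldType) n : noetherian {mpoly F[n]}.
Proof.
move=> J iJ.
pose L := [set m | exists p, [/\ J p, p != 0 & mlead p = m]].
have [t [tL Lt]] := dickson L.
have /choice[g gP] m : exists p, m \in t -> [/\ J p, p != 0 & mlead p = m].
  have [/tL[p pP]|] := boolP (m \in t); last by exists 0.
  by exists p.
exists (map g t); apply/seteqP; split; last first.
  apply: generated_min => // p /mapP[m mt ->].
  by case: (gP m mt).
have iG := generated_ideal (map g t).
move=> p; move m_def: (mlead p) => m; move: p m_def.
elim/(well_founded_ind (@ltom_wf n)): m => m IH p pm Jp.
have [->|p0] := eqVneq p 0; first exact: ideal0.
have [m' m't le_m'] : exists2 m', m' \in t & (m' <= m)%MM.
  by apply: Lt; exists p.
have [Jq q0 qm'] := gP m' m't.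
pose r := (mleadc p / mleadc (g m')) *: 'X_[m - m'] * g m'.
have cpn0 : mleadc p != 0 by rewrite mleadc_eq0.
have cqn0 : mleadc (g m') != 0 by rewrite mleadc_eq0.
have c0 : mleadc p / mleadc (g m') != 0 by rewrite mulf_neq0 ?invr_eq0.
have cX0 : (mleadc p / mleadc (g m')) *: 'X_[m - m'] != 0 :> {mpoly F[n]}.
  by rewrite mscalerI negb_or c0 -msize_poly_eq0 msizeX.
have rm : mlead r = m by rewrite mleadM// mleadZ// mleadXm qm' submK.
have rc : mleadc r = mleadc p.
  by rewrite mleadM// mleadcM mleadZ// mleadXm mcoeffZ mcoeffX eqxx mulr1 divfK.
have Gr : generated (map g t) r.
  by apply: idealMl => //; apply/mem_generated/map_f.
rewrite -[p](subrK r); apply: idealD => //.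
have [->|pr0] := eqVneq (p - r) 0; first exact: ideal0.
apply: (IH (mlead (p - r))) => //; last first.
  by apply: idealB => //; apply: idealMl.
rewrite lt_neqAle; apply/andP; split.
  apply: contra_neq pr0 => prm; apply/eqP.
  by rewrite -mleadc_eq0 prm mcoeffB -[X in _ - r@_X]rm rc pm subrr.
by apply: le_trans (mleadB_le _ _) _; rewrite rm pm joinxx.
Qed.

(** The image of a polynomial ring, localized at some elements, is
  Noetherian: an ideal is generated by the images of generators of its
  inverse image. *)
Lemma noetherian_of_mpoly (F : fieldType) n (A : comNzRingType)
    (f : {rmorphism {mpoly F[n]} -> A}) :
  (forall a, exists u v p, u * v = 1 /\ u * a = f p) -> noetherian A.
Proof.
move=> fA J iJ.
have [|s Es] := @mpoly_noetherian F n (f @^-1` J).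
  apply/idealP; split=> [|x y|a x] /=.
  - by rewrite rmorph0; apply: ideal0.
  - by rewrite rmorphD; apply: idealD.
  - by rewrite rmorphM; apply: idealMl.
have iG := generated_ideal (map f s).
exists (map f s); apply/seteqP; split; last first.
  apply: generated_min => // _ /mapP[p ps ->].
  by have: (f @^-1` J) p by rewrite Es; apply: mem_generated.
move=> a Ja; have [u [v [p [uv1 uap]]]] := fA a.
apply: (ideal_unitM iG uv1); rewrite uap.
have : (f @^-1` J) p by rewrite /= -uap; apply: idealMl.
rewrite Es => -[r ->]; rewrite rmorph_sum; apply: ideal_sum => // i _.
by rewrite rmorphM; apply: idealMl => //; apply/mem_generated/map_f/mem_nth.
Qed.

(** * Chains of ideals and algebraic relations *)

Section Collapse.
Variables (A : comNzRingType) (F : fieldType) (k : {rmorphism F -> A}).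

(** In a relation between monomials in the [x i], keep at each step [i] the
  terms whose exponent of [x i] is minimal: after dividing by that power of
  [x i], the other terms fall into [J i.+1].  In the end a single monomial
  survives, with its coefficient alone. *)
Lemma relation_collapse n (J : nat -> set A) (x : 'I_n -> A) N
    (a : {ffun 'I_n -> 'I_N} -> F) :
  (forall i, (i <= n)%N -> ideal (J i)) ->
  (forall i : 'I_n, J i `<=` J i.+1) ->
  (forall i : 'I_n, J i.+1 (x i)) ->
  (forall (i : 'I_n) y, J i (x i * y) -> J i y) ->
  (exists m, a m != 0) ->
  J 0%N (\sum_m k (a m) * \prod_i x i ^+ m i) -> J n 1.
Proof.
move=> iJ JS Jx regx [m0 am0] J0.
have regX (i : 'I_n) v y : J i (x i ^+ v * y) -> J i y.
  by elim: v => [|v IH]; rewrite ?mul1r// exprS -mulrA => /regx/IH.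
pose tail j (m : {ffun 'I_n -> 'I_N}) := \prod_(i < n | (j <= i)%N) x i ^+ m i.
have main j : (j <= n)%N -> exists S : {set {ffun 'I_n -> 'I_N}},
    [/\ exists m, m \in S, forall m, m \in S -> a m != 0,
        forall m m' (i : 'I_n), m \in S -> m' \in S -> (i < j)%N -> m i = m' i
      & J j (\sum_(m in S) k (a m) * tail j m)].
  elim: j => [|j IH] ltjn.
    exists [set m | a m != 0]%SET; split=> [|m||]; rewrite ?inE//.
      by exists m0; rewrite inE.
    suff <- : \sum_m k (a m) * \prod_i x i ^+ m i =
        \sum_(m in [set m | a m != 0]%SET) k (a m) * tail 0%N m by [].
    rewrite (bigID (fun m => a m != 0)) /= [X in _ + X]big1 ?addr0.
      by apply: eq_bigl => m; rewrite inE.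
    by move=> m; rewrite negbK => /eqP ->; rewrite rmorph0 mul0r.
  have [S [[m1 Sm1] Sa Seq JS0]] := IH (ltnW ltjn).
  pose l := Ordinal ltjn.
  case: (arg_minnP (fun m : {ffun 'I_n -> 'I_N} => m l : nat) Sm1) => m2 Sm2' minm.
  have Sm2 : m2 \in S by [].
  set v := m2 l : nat in minm.
  exists [set m in S | m l == v :> nat]%SET; split.
  - by exists m2; rewrite inE Sm2 eqxx.
  - by move=> m /setIdP[/Sa].
  - move=> m m' i /setIdP[Sm /eqP ml] /setIdP[Sm' /eqP ml'].
    rewrite ltnS leq_eqVlt => /predU1P[il|]; last exact: Seq.
    rewrite (_ : i = l); last exact: val_inj.
    by apply: val_inj; rewrite /= ml ml'.
  have tailS m : tail j m = x l ^+ m l * tail j.+1 m.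
    rewrite /tail (bigD1 l)//=; congr (_ * _); apply: eq_bigl => i.
    by rewrite ltn_neqAle -val_eqE eq_sym andbC.
  have iJ' : ideal (J j.+1) by exact: iJ.
  pose hi := \sum_(m in S | m l != v :> nat)
    k (a m) * (x l ^+ (m l - v.+1) * tail j.+1 m).
  have Esum : \sum_(m in S) k (a m) * tail j m = x l ^+ v *
      (\sum_(m in S | m l == v :> nat) k (a m) * tail j.+1 m + x l * hi).
    rewrite (bigID (fun m : {ffun 'I_n -> 'I_N} => m l == v :> nat)) /= mulrDr.
    rewrite /hi !mulr_sumr; congr (_ + _); apply: eq_bigr => m /andP[Sm mv].
      by rewrite tailS (eqP mv) mulrCA.
    have ltv : (v < m l)%N by rewrite ltn_neqAle eq_sym mv minm.
    rewrite tailS -[X in x l ^+ X](subnKC ltv) exprD exprSr.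
    by ring.
  rewrite Esum in JS0; have Jsum := JS l _ (regX l _ _ JS0).
  rewrite (eq_bigl (fun m => (m \in S) && (m l == v :> nat))); last first.
    by move=> m; rewrite inE.
  rewrite -[X in J _ X](addrK (x l * hi)).
  by apply: idealB => //; apply: idealMr => //; apply: (Jx l).
have [S [[m Sm] Sa Seq Jn]] := main n (leqnn n).
have iJn : ideal (J n) by exact: iJ.
have uam : k (a m) * k (a m)^-1 = 1 by rewrite -rmorphM divff ?rmorph1// Sa.
apply: (ideal_unitM iJn uam).
rewrite (big_pred1 m) in Jn; last first.
  move=> m' /=; apply/idP/eqP => [Sm'|->//].
  by apply/ffunP => i; apply: Seq.
rewrite /tail big1 // in Jn => i.
by rewrite leqNgt ltn_ord.
Qed.

(** The units serve to clear denominators: membership in an ideal and regularity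
  do not see them. *)
Definition growth_le C d := forall x : 'I_d.+1 -> A,
  exists u v E, (forall i, u i * v i = 1) /\
    forall N, exists (T : finType) (e : T -> A),
      (#|T| <= C * (E * N) ^ d)%N /\
      forall m : {ffun 'I_d.+1 -> 'I_N}, exists b : T -> F,
        \prod_i (u i * x i) ^+ m i = \sum_t k (b t) * e t.

(** There are [N ^ d.+1] monomials in the [x i] with exponents less than [N]:
  they are dependent for large [N], and [relation_collapse] applies. *)
Lemma chain_collapse C d (J : nat -> set A) (x : 'I_d.+1 -> A) :
  growth_le C d ->
  (forall i, (i <= d.+1)%N -> ideal (J i)) ->
  (forall i : 'I_d.+1, J i `<=` J i.+1) ->
  (forall i : 'I_d.+1, J i.+1 (x i)) ->
  (forall (i : 'I_d.+1) y, J i (x i * y) -> J i y) ->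
  J d.+1 1.
Proof.
move=> gA iJ JS Jx regx.
have [u [v [E [uv1 gN]]]] := gA x; pose N := (C * E ^ d).+1.
have [T [e [leT spanT]]] := gN N.
have i0 : ideal [set (0 : A)].
  apply/idealP; split=> //= [_ _ -> ->|a _ ->]; first by rewrite addr0.
  by rewrite mulr0.
pose mon (m : {ffun 'I_d.+1 -> 'I_N}) := \prod_i (u i * x i) ^+ m i.
have [fmon|] := pselect (free_mod k [set 0] [pred _ | true] mon).
  have : (#|[pred _ : {ffun 'I_d.+1 -> 'I_N} | true]| <= #|[pred _ : T | true]|)%N.
    apply: (@free_le_span _ _ k [set 0] (range mon) _ _ _ _ mon e) => //.
    move=> _ [m _ <-]; have [b Eb] := spanT m; exists b; rewrite /mon Eb /=.
    by rewrite (eq_bigl xpredT)// subrr.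
  rewrite [X in (X <= _)%N](_ : _ = N ^ d.+1)%N; last first.
    by rewrite -[X in (_ ^ X)%N]card_ord -[X in (X ^ _)%N]card_ord -card_ffun.
  move=> leNT; have := leq_trans leNT leT.
  by rewrite expnMn mulnA expnS leq_pmul2r ?ltnn// expn_gt0.
case/existsNP=> a /not_implyP[sum0 /existsNP[m /not_implyP[_ /eqP am]]].
apply: (@relation_collapse d.+1 J (fun i => u i * x i) N a) => //.
- by move=> i; apply: idealMl => //; apply: iJ.
- move=> i y; rewrite -mulrA => uxy; apply: regx.
  by apply: (ideal_unitM _ (uv1 i)) => //; apply/iJ/ltnW.
- by exists m.
move: sum0; rewrite (eq_bigl xpredT)// => ->.
by apply: ideal0; apply: iJ.
Qed.

Lemma growth_prime_chain C d K n : growth_le C d ->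
  strict_chain (@prime_ideal A) K n -> (n <= d)%N.
Proof.
move=> gA [pK KS]; rewrite leqNgt; apply/negP => ltdn.
have lt_n (i : 'I_d.+1) : (i < n)%N by apply: leq_trans ltdn; rewrite ltn_ord.
have /choice[x xP] (i : 'I_d.+1) : exists x, K i.+1 x /\ ~ K i x.
  by have [_ /existsNP[x /not_implyP[? ?]]] := KS i (lt_n i); exists x.
have /prime_idealP[_ + _] := pK _ ltdn; apply.
apply: (chain_collapse gA (x := x)) => [i lei|i|i|i y].
- by have /prime_idealP[] := pK _ (leq_trans lei ltdn).
- by have [] := KS i (lt_n i).
- by have [] := xP i.
have /prime_idealP[_ _ pKi] := pK _ (ltnW (lt_n i)).
by case: (xP i) => _ nKx /pKi[].
Qed.

Lemma growth_regular C d (s : seq A) : growth_le C d ->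
  regular_sequence s -> (size s <= d)%N.
Proof.
move=> gA [regs s1]; rewrite leqNgt; apply/negP => ltds; apply: s1.
have lt_s (i : 'I_d.+1) : (i < size s)%N.
  by apply: leq_trans ltds; rewrite ltn_ord.
have sub i j : (i <= j)%N -> generated (take i s) `<=` generated (take j s).
  move=> leij; apply: generated_min; first exact: generated_ideal.
  by move=> x xi; apply: mem_generated; apply: (@mem_take i); rewrite take_takel.
rewrite -[s]take_size; apply: (sub d.+1 (size s)) => //.
apply: (chain_collapse gA (J := fun i => generated (take i s))
  (x := fun i => s`_i)) => [i lei|i|i|i y].
- exact: generated_ideal.
- exact: sub.
- by apply: mem_generated; rewrite (take_nth 0 (lt_s i)) mem_rcons mem_head.
exact: regs.
Qed.

End Collapse.

(** * The local ring of affine space at the origin *)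

Section Loc.
Variables (F : fieldType) (d : nat).
Local Notation "x %:F" := (tofrac x) (at level 1, format "x %:F").
Local Notation poly := {mpoly F[d]}.

Definition regular_at0 : {pred {fraction poly}} :=
  fun x => `[< exists p q : poly, q@_0%MM != 0 /\ x * q%:F = p%:F >].

Lemma regular_at0P x :
  reflect (exists p q : poly, q@_0%MM != 0 /\ x * q%:F = p%:F)
    (x \in regular_at0).
Proof. exact: asboolP. Qed.

Lemma mcoeff0M (p q : poly) : (p * q)@_0%MM = p@_0%MM * q@_0%MM.
Proof. exact: rmorphM. Qed.

Lemma regular_at0_subring : subring_closed regular_at0.
Proof.
split=> [|x y|x y].
- by apply/regular_at0P; exists 1, 1; rewrite mcoeff1 eqxx oner_neq0 mul1r.
- move=> /regular_at0P[p [q [q0 xq]]] /regular_at0P[p' [q' [q'0 yq']]].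
  apply/regular_at0P; exists (p * q' - p' * q), (q * q').
  rewrite mcoeff0M mulf_neq0//; split=> //.
  by rewrite tofracB !tofracM -xq -yq'; ring.
move=> /regular_at0P[p [q [q0 xq]]] /regular_at0P[p' [q' [q'0 yq']]].
apply/regular_at0P; exists (p * p'), (q * q').
by rewrite mcoeff0M mulf_neq0// !tofracM -xq -yq' mulrACA.
Qed.

HB.instance Definition _ := GRing.isSubringClosed.Build _ regular_at0
  regular_at0_subring.

Record loc := Loc { loc_val : {fraction poly}; _ : loc_val \in regular_at0 }.

HB.instance Definition _ := [isSub for loc_val].
HB.instance Definition _ := [Choice of loc by <:].
HB.instance Definition _ := [SubChoice_isSubComNzRing of loc by <:].

Lemma regular_at0_poly (p : poly) : p%:F \in regular_at0.
Proof.
by apply/regular_at0P; exists p, 1; rewrite mcoeff1 eqxx oner_neq0 tofrac1 mulr1.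
Qed.

Definition emb p : loc := Loc (regular_at0_poly p).

Lemma emb_zmod : zmod_morphism emb.
Proof. by move=> p q; apply: val_inj; rewrite rmorphB /= tofracB. Qed.

Lemma emb_monoid : monoid_morphism emb.
Proof.
split=> [|p q]; apply: val_inj; first by rewrite rmorph1 /= tofrac1.
by rewrite rmorphM /= tofracM.
Qed.

HB.instance Definition _ := GRing.isZmodMorphism.Build poly loc emb emb_zmod.
HB.instance Definition _ := GRing.isMonoidMorphism.Build poly loc emb emb_monoid.

Lemma emb0 : emb 0 = 0. Proof. exact: rmorph0. Qed.

Lemma emb1 : emb 1 = 1. Proof. exact: rmorph1. Qed.

Lemma embD : {morph emb : p q / p + q}. Proof. exact: rmorphD. Qed.

Lemma embB : {morph emb : p q / p - q}. Proof. exact: rmorphB. Qed.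

Lemma embM : {morph emb : p q / p * q}. Proof. exact: rmorphM. Qed.

Lemma emb_inj : injective emb.
Proof. by move=> p q /(congr1 loc_val) /= /eqP; rewrite tofrac_eq => /eqP. Qed.

Lemma loc_frac (r : loc) :
  exists p q : poly, q@_0%MM != 0 /\ r * emb q = emb p.
Proof.
case: r => x xP; have /regular_at0P[p [q [q0 xq]]] := xP.
by exists p, q; split=> //; apply: val_inj; rewrite rmorphM.
Qed.

Lemma emb_unit (q : poly) : q@_0%MM != 0 -> exists s, emb q * s = 1.
Proof.
move=> q0; have qF0 : q%:F != 0.
  by rewrite tofrac_eq0; apply: contra_neq q0 => ->; rewrite mcoeff0.
have qV : q%:F^-1 \in regular_at0.
  by apply/regular_at0P; exists 1, q; rewrite mulVf// tofrac1.
by exists (Loc qV); apply: val_inj; rewrite rmorphM rmorph1 /= divff.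
Qed.

End Loc.

(** * Monomial ideals *)

Section MonomialIdeal.
Variables (F : fieldType) (d : nat).
Local Notation poly := {mpoly F[d]}.
Local Notation loc := (loc F d).
Implicit Types (S : {pred 'X_{1..d}}) (p q : poly) (r : loc).

Definition upclosed S := forall m m', m \in S -> (m + m')%MM \in S.

Definition monideal S : set loc := [set r | exists p q,
  [/\ q@_0%MM != 0, r * emb q = emb p & {subset msupp p <= S}]].

Lemma msuppM_sub S S' S'' p q :
  (forall m m', m \in S -> m' \in S' -> (m + m')%MM \in S'') ->
  {subset msupp p <= S} -> {subset msupp q <= S'} ->
  {subset msupp (p * q) <= S''}.
Proof.
move=> SS' pS qS' m /msuppM_le/allpairsP[[m1 m2] /= [m1p m2q ->]].
by apply: SS'; [apply: pS|apply: qS'].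
Qed.

Lemma msuppD_sub S p q :
  {subset msupp p <= S} -> {subset msupp q <= S} ->
  {subset msupp (p + q) <= S}.
Proof. by move=> pS qS m /msuppD_le; rewrite mem_cat => /orP[/pS|/qS]. Qed.

Lemma msuppM_upclosed S p q : upclosed S ->
  {subset msupp p <= S} -> {subset msupp (p * q) <= S}.
Proof.
move=> uS pS; apply: (@msuppM_sub S predT) => // m m' mS _.
exact: uS.
Qed.

Lemma monidealM S S' S'' r s :
  (forall m m', m \in S -> m' \in S' -> (m + m')%MM \in S'') ->
  monideal S r -> monideal S' s -> monideal S'' (r * s).
Proof.
move=> SS' [p [q [q0 rq pS]]] [p' [q' [q'0 sq' p'S']]].
exists (p * p'), (q * q'); rewrite mcoeff0M mulf_neq0// !embM -rq -sq'.
by rewrite mulrACA; split=> //; apply: msuppM_sub pS p'S'.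
Qed.

Lemma monideal_ideal S : upclosed S -> ideal (monideal S).
Proof.
move=> uS; apply/idealP; split.
- exists 0, 1; rewrite mcoeff1 eqxx oner_neq0 !emb0 mul0r; split=> // m.
  by rewrite msupp0.
- move=> r s [p [q [q0 rq pS]]] [p' [q' [q'0 sq' p'S]]].
  exists (p * q' + p' * q), (q * q').
  rewrite mcoeff0M mulf_neq0// embD !embM -rq -sq'; split=> //.
    by rewrite mulrDl mulrA [emb q * _]mulrC mulrA.
  by apply: msuppD_sub; apply: msuppM_upclosed.
move=> a r; apply: (@monidealM predT) => [m m' _ mS|].
  by rewrite addmC; apply: uS.
by have [p [q [q0 aq]]] := loc_frac a; exists p, q.
Qed.

Lemma monideal_sub S S' : {subset S <= S'} -> monideal S `<=` monideal S'.
Proof.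
move=> SS' r [p [q [q0 rq pS]]]; exists p, q; split=> // m mp.
exact/SS'/pS.
Qed.

(** The terms of [p] outside [S] of least degree survive, up to a nonzero
  scalar, in a product with a polynomial having a constant term. *)
Lemma msupp_div_sub S p q : upclosed S -> q@_0%MM != 0 ->
  {subset msupp (p * q) <= S} -> {subset msupp p <= S}.
Proof.
move=> uS q0 pqS m.
have [n] := ubnP (mdeg m); elim: n m => // n IH m; rewrite ltnS => ltm mp.
apply: contraT => mS.
have /memN_msupp_eq0/eqP : m \notin msupp (p * q) by apply: contra mS => /pqS.
pose q' := q - (q@_0%MM)%:MP.
rewrite -[q](subrK (q@_0%MM)%:MP) -/q' mulrDr mcoeffD [_ * _%:MP]mulrC.
rewrite mcoeffCM [X in X + _]memN_msupp_eq0 ?add0r.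
  by rewrite mulf_eq0 (negbTE q0) /= mcoeff_eq0 mp.
apply/negP => /msuppM_le/allpairsP[[m1 m2] /= [m1p m2q' Em]].
have m20 : m2 != 0%MM.
  apply: contraTneq m2q' => ->.
  by rewrite -mcoeff_eq0 mcoeffB mcoeffC eqxx mulr1 subrr.
case/negP: mS; rewrite Em; apply/uS/IH => //.
apply: leq_trans ltm; rewrite Em mdegD -addn1 leq_add2l lt0n.
by rewrite mdeg_eq0.
Qed.

Lemma monideal_msupp S r p q : upclosed S -> q@_0%MM != 0 ->
  r * emb q = emb p -> monideal S r -> {subset msupp p <= S}.
Proof.
move=> uS q0 rq [p' [q' [q'0 rq' p'S]]].
apply: (@msupp_div_sub S p q') => //.
have -> : p * q' = p' * q.
  by apply: emb_inj; rewrite !embM -rq -rq' mulrAC.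
exact: msuppM_upclosed.
Qed.

Lemma mem_monideal S p : upclosed S ->
  monideal S (emb p) <-> {subset msupp p <= S}.
Proof.
move=> uS; split; last first.
  by move=> pS; exists p, 1; rewrite mcoeff1 eqxx oner_neq0 emb1 mulr1.
by apply: (@monideal_msupp _ _ _ 1); rewrite // ?mcoeff1 ?eqxx ?oner_neq0//
  emb1 mulr1.
Qed.

Lemma monidealX S m : upclosed S -> monideal S (emb 'X_[m]) <-> m \in S.
Proof.
move=> uS; rewrite mem_monideal//; split=> [|mS m'].
  by apply; rewrite msuppX mem_head.
by rewrite msuppX inE => /eqP ->.
Qed.

Lemma monideal_gen S J : ideal J -> (forall m, m \in S -> J (emb 'X_[m])) ->
  monideal S `<=` J.
Proof.
move=> iJ SJ r [p [q [q0 rq pS]]]; have [s qs] := emb_unit q0.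
apply: (ideal_unitM iJ qs); rewrite mulrC rq [p]mpolyE rmorph_sum.
rewrite big_seq_cond; apply: ideal_sum => // m; rewrite andbT => /pS/SJ.
by rewrite -mul_mpolyC rmorphM; apply: idealMl.
Qed.

Lemma mpoly_split S p : exists p1 p2, [/\ p = p1 + p2,
  {subset msupp p1 <= S} & {subset msupp p2 <= [predC S]}].
Proof.
exists (\sum_(m <- msupp p | m \in S) p@_m *: 'X_[m]).
exists (\sum_(m <- msupp p | m \notin S) p@_m *: 'X_[m]).
have supp (P : pred 'X_{1..d}) :
    {subset msupp (\sum_(m <- msupp p | P m) p@_m *: 'X_[m]) <= P}.
  move=> m /msupp_sum_le/flattenP[s /mapP[m']].
  rewrite mem_filter => /andP[Pm' _ ->] /msuppZ_le.
  by rewrite msuppX inE => /eqP ->.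
split; [|exact: supp|exact: (supp (fun m => m \notin S))].
by rewrite [LHS]mpolyE (bigID (mem S)).
Qed.

(** Prime monomial ideals: the polynomials with terms outside [S] form a
  domain, onto which the others retract. *)
Lemma monideal_prime S r s : upclosed S ->
  (forall m m', (m + m')%MM \in S -> m \in S \/ m' \in S) ->
  monideal S (r * s) -> monideal S r \/ monideal S s.
Proof.
move=> uS pS rsS; have [p [q [q0 rq]]] := loc_frac r.
have [p' [q' [q'0 sq']]] := loc_frac s.
have : {subset msupp (p * p') <= S}.
  apply: (@monideal_msupp S (r * s) _ (q * q') uS _ _ rsS).
    by rewrite mcoeff0M mulf_neq0.
  by rewrite !embM -rq -sq' mulrACA.
have [p1 [p2 [Ep p1S p2S]]] := mpoly_split S p.
have [p1' [p2' [Ep' p1'S p2'S]]] := mpoly_split S p'.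
have supp2 : {subset msupp (p2 * p2') <= [predC S]}.
  apply: msuppM_sub p2S p2'S => m m'; rewrite !inE => mS m'S.
  by apply/negP => /pS[]; apply/negP.
rewrite Ep Ep' => prodS.
have supp2S : {subset msupp (p2 * p2') <= S}.
  have -> : p2 * p2' = (p1 + p2) * (p1' + p2') - (p1 * (p1' + p2') + p1' * p2)
    by ring.
  apply: msuppD_sub => // m; rewrite (perm_mem (msuppN _)); move: m.
  by apply: msuppD_sub; apply: msuppM_upclosed.
have : p2 * p2' == 0.
  rewrite -msupp_eq0; case E: (msupp _) => [//|m l].
  have m2 : m \in msupp (p2 * p2') by rewrite E mem_head.
  by case/negP: (supp2 _ m2); apply: supp2S.
rewrite mulf_eq0 => /orP[/eqP p20|/eqP p20].
  by left; exists p, q; split=> //; rewrite Ep p20 addr0.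
by right; exists p', q'; split=> //; rewrite Ep' p20 addr0.
Qed.

Definition degge n : {pred 'X_{1..d}} := [pred m | (n <= mdeg m)%N].

Lemma degge_upclosed n : upclosed (degge n).
Proof. by move=> m m' /leq_trans; apply; rewrite mdegD leq_addr. Qed.

Lemma degge1E m : (m \in degge 1) = (m != 0%MM).
Proof. by rewrite inE lt0n mdeg_eq0. Qed.

(** Modulo a monomial ideal containing all monomials of degree at least [n], a
  denominator [1 - u] without constant term in [u] can be inverted by a
  truncated geometric series. *)
Lemma monideal_spanned S n r : upclosed S ->
  (forall m, (n <= mdeg m)%N -> m \in S) ->
  exists p, {subset msupp p <= [predC S]} /\ monideal S (r - emb p).
Proof.
move=> uS Sn; have [p [q [q0 rq]]] := loc_frac r.
pose u := 1 - (q@_0%MM)^-1%:MP * q.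
have uE : (q@_0%MM)^-1%:MP * q = 1 - u by rewrite opprB addrC subrK.
pose w := (q@_0%MM)^-1%:MP * \sum_(j < n) u ^+ j.
have qw : w * q = 1 - u ^+ n.
  rewrite mulrAC uE -[RHS]opprB subrX1 -mulNr; congr (_ * _).
  by rewrite [RHS]opprB.
have un : {subset msupp (u ^+ n) <= S}.
  suff : {subset msupp (u ^+ n) <= degge n} by move=> H m /H/Sn.
  elim: n {Sn w qw} => [//|n IH]; rewrite exprS.
  apply: (@msuppM_sub (degge 1) _ _) IH => [m m'|m].
    by rewrite !inE mdegD -[n.+1]add1n; apply: leq_add.
  rewrite degge1E; apply: contraTneq => ->.
  rewrite -mcoeff_eq0 mcoeffB mcoeffCM mcoeff1 eqxx.
  by rewrite mulVf// subrr.
have [p1 [p2 [Ep p1S p2S]]] := mpoly_split S (p * w).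
exists p2; split=> //; exists (p * u ^+ n + p1 * q), q; split=> //.
  rewrite mulrBl rq -embM -embB; congr emb.
  have -> : p2 = p * w - p1 by rewrite Ep addrAC subrr add0r.
  by rewrite mulrBl -mulrA qw; ring.
apply: msuppD_sub; last exact: msuppM_upclosed.
by rewrite mulrC; apply: msuppM_upclosed.
Qed.

Lemma degge1_unit r : ~ monideal (degge 1) r -> exists s, r * s = 1.
Proof.
have [p [q [q0 rq]]] := loc_frac r => rm.
have [p0|/emb_unit[s ps]] := eqVneq (p@_0%MM) 0; last first.
  by exists (emb q * s); rewrite mulrA rq.
case: rm; exists p, q; split=> // m mp; rewrite degge1E.
by apply: contraTneq mp => ->; rewrite -mcoeff_eq0 p0.
Qed.

Lemma residue_const r : exists c : F, monideal (degge 1) (r - emb c%:MP).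
Proof.
have [|m|p [pS rp]] := @monideal_spanned (degge 1) 1 r.
- exact: degge_upclosed.
- by [].
exists (p@_0%MM); rewrite -(_ : p = (p@_0%MM)%:MP)//.
apply/mpolyP => m; rewrite mcoeffC; have [->|m0] := eqVneq m 0%MM.
  by rewrite mulr1.
rewrite mulr0; apply: memN_msupp_eq0; apply/negP => /pS.
by rewrite inE degge1E m0.
Qed.

End MonomialIdeal.

(** * The extension by a quadratic algebra *)

(** The indices [None], [Some None] and [Some (Some i)] stand for the basis
  vectors [1], [y] and [g i] of an [R]-algebra in which [g i ^+ 2 = w i * y],
  all other products of two vectors among [y] and the [g i] being [0]. *)
Definition ext (R : comNzRingType) (c : nat) (w : 'I_c -> R) :=
  {ffun option (option 'I_c) -> R}.

Section Ext.
Variables (R : comNzRingType) (c : nat) (w : 'I_c -> R).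

Local Notation idx := (option (option 'I_c)).
Local Notation iy := (Some None).
Local Notation ig i := (Some (Some i)).

Local Notation ext := (ext w).

HB.instance Definition _ := GRing.Zmodule.on ext.

Implicit Types a b : ext.

Definition form a b := \sum_i w i * (a (ig i) * b (ig i)).

Definition ext_mul a b : ext := [ffun k =>
  match k with
  | None => a None * b None
  | iy => a None * b iy + a iy * b None + form a b
  | ig i => a None * b (ig i) + a (ig i) * b None
  end].

Definition ext_one : ext := [ffun k => (k == None)%:R].

Lemma formC a b : form a b = form b a.
Proof. by apply: eq_bigr => i _; rewrite [a _ * _]mulrC. Qed.

Lemma formDl a b a' : form (a + b) a' = form a a' + form b a'.
Proof.
by rewrite -big_split; apply: eq_bigr => i _; rewrite ffunE mulrDl mulrDr.
Qed.

Lemma formMl a b a' : form (ext_mul a b) a' =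
  a None * form b a' + b None * form a a'.
Proof.
rewrite !mulr_sumr -big_split; apply: eq_bigr => i _; rewrite ffunE /=.
by ring.
Qed.

Lemma ext_mulC : commutative ext_mul.
Proof.
move=> a b; apply/ffunP => -[[i|]|]; rewrite !ffunE; last exact: mulrC.
  by ring.
by rewrite formC; ring.
Qed.

Lemma ext_mulA : associative ext_mul.
Proof.
move=> a b a'; apply/ffunP => k.
rewrite [LHS]ffunE [RHS]ffunE; case: k => [[i|]|].
- by rewrite !ffunE; ring.
- rewrite formMl [form a _]formC formMl !ffunE.
  by rewrite [form b a]formC [form a' a]formC [form b a']formC; ring.
by rewrite !ffunE mulrA.
Qed.

Lemma ext_mul1 : left_id ext_one ext_mul.
Proof.
move=> a; have form0 : form ext_one a = 0.
  by rewrite /form big1// => i _; rewrite ffunE /= mul0r mulr0.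
apply/ffunP => -[[i|]|]; rewrite ffunE ?form0 !ffunE /=.
- by rewrite mul1r mul0r addr0.
- by rewrite mul1r mul0r !addr0.
by rewrite mul1r.
Qed.

Lemma ext_mulDl : left_distributive ext_mul +%R.
Proof.
by move=> a b a'; apply/ffunP => -[[i|]|];
  rewrite !ffunE ?formDl; ring.
Qed.

Lemma ext_one_neq0 : ext_one != 0.
Proof.
apply/eqP => /(congr1 (fun a : ext => a None)); rewrite !ffunE eqxx.
exact/eqP/oner_neq0.
Qed.

HB.instance Definition _ := GRing.Zmodule_isComNzRing.Build ext
  ext_mulA ext_mulC ext_mul1 ext_mulDl ext_one_neq0.

Lemma mulNE a b : (a * b) None = a None * b None.
Proof. by rewrite ffunE. Qed.

Lemma mulyE a b : (a * b) iy = a None * b iy + a iy * b None + form a b.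
Proof. by rewrite ffunE. Qed.

Lemma mulgE a b i : (a * b) (ig i) = a None * b (ig i) + a (ig i) * b None.
Proof. by rewrite ffunE. Qed.

Lemma oneE k : (1 : ext) k = (k == None)%:R.
Proof. by rewrite ffunE. Qed.

Definition inc (r : R) : ext := [ffun k => if k is None then r else 0].

Lemma incME r a k : (inc r * a) k = r * a k.
Proof.
have form0 : form (inc r) a = 0.
  by rewrite /form big1// => i _; rewrite ffunE /= mul0r mulr0.
case: k => [[i|]|]; rewrite ffunE ?form0 !ffunE //.
  by rewrite mul0r addr0.
by rewrite mul0r !addr0.
Qed.

Lemma inc_zmod : zmod_morphism inc.
Proof.
by move=> r s; apply/ffunP => -[k|]; rewrite !ffunE // subrr.
Qed.

Lemma inc_monoid : monoid_morphism inc.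
Proof.
split=> [|r s]; apply/ffunP => k.
  by rewrite [RHS]ffunE ffunE; case: k.
by rewrite incME !ffunE; case: k; rewrite ?mulr0.
Qed.

HB.instance Definition _ := GRing.isZmodMorphism.Build R ext inc inc_zmod.
HB.instance Definition _ := GRing.isMonoidMorphism.Build R ext inc inc_monoid.

Definition bas (l : idx) : ext := [ffun k => (k == l)%:R].

Lemma basE l k : bas l k = (k == l)%:R.
Proof. by rewrite ffunE. Qed.

Lemma basN : bas None = 1.
Proof. by apply/ffunP => k; rewrite !ffunE. Qed.

Lemma ext_sumE (I : Type) (r : seq I) (P : pred I) (f : I -> ext) k :
  (\sum_(i <- r | P i) f i) k = \sum_(i <- r | P i) f i k.
Proof. by elim/big_ind2: _ => [|_ a _ b <- <-|//]; rewrite ffunE. Qed.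

Lemma ext_basis a : a = \sum_k inc (a k) * bas k.
Proof.
apply/ffunP => k; rewrite ext_sumE (bigD1 k)//= incME basE eqxx mulr1.
rewrite big1 ?addr0// => l lk.
by rewrite incME basE eq_sym (negbTE lk) mulr0.
Qed.

Lemma bas_g_sqr i : bas (ig i) * bas (ig i) = inc (w i) * bas iy.
Proof.
apply/ffunP => k; rewrite incME basE; case: k => [[j|]|].
- by rewrite mulgE !basE mulr0 mul0r addr0 mulr0.
- rewrite mulyE !basE !(mulr0, mul0r, add0r) eqxx mulr1.
  rewrite /form (bigD1 i)//= basE eqxx !mulr1 big1 ?addr0// => j ji.
  by rewrite !basE (_ : _ == _ = false) ?mulr0//; apply/negbTE; apply: contra ji.
by rewrite mulNE !basE /= !mulr0.
Qed.

(** An element is invertible when its component in [R] is, as it then is a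
  unit times [1 + n] with [n ^+ 3 = 0]. *)
Lemma ext_unit a s : a None * s = 1 -> exists b, a * b = 1.
Proof.
move=> as1; pose n := a * inc s - 1.
have n0 : n None = 0 by rewrite !ffunE /= as1 subrr.
have nn i : (n * n) (ig i) = 0 by rewrite mulgE n0 mul0r mulr0 addr0.
have n3 : n * (n * n) = 0.
  apply/ffunP => -[[i|]|]; rewrite [RHS]ffunE.
  - by rewrite mulgE nn mulNE n0 !mulr0 addr0.
  - rewrite mulyE mulNE n0 mul0r !mulr0 !add0r /form big1// => i _.
    by rewrite nn !mulr0.
  by rewrite mulNE n0 mul0r.
exists (inc s * (1 - n + n * n)); rewrite mulrA -[a * _](subrK 1) -/n.
by transitivity (1 + n * (n * n)); [ring | rewrite n3 addr0].
Qed.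

Definition coordset (J : idx -> set R) : set ext := [set a | forall k, J k (a k)].

Lemma coordset_ideal (J : idx -> set R) : (forall k, ideal (J k)) ->
  (forall k, J None `<=` J k) ->
  (forall i r, J (ig i) r -> J iy (w i * r)) ->
  ideal (coordset J).
Proof.
move=> iJ JN Jw; apply/idealP; split=> [k|a b Ja Jb k|b a Ja k].
- by rewrite ffunE; apply: ideal0.
- by rewrite ffunE; apply: idealD.
have Ma k' s : J k' (s * a k') by apply: idealMl.
have MN k' s : J k' (s * a None) by apply: idealMl => //; apply: JN.
have iD k' x y : J k' x -> J k' y -> J k' (x + y) by apply: idealD.
case: k => [[i|]|]; rewrite ffunE; [| |exact: Ma].
  by apply: iD; [exact: Ma|exact: MN].
apply: (iD); first by apply: iD; [exact: Ma|exact: MN].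
apply: ideal_sum => // i _; rewrite mulrCA.
by apply: idealMl => //; apply: Jw.
Qed.

End Ext.

Arguments inc {R c} w r.
Arguments bas {R c} w l.

(** * Counting monomials *)

Section CountMonomials.
Variable d : nat.

Lemma leq_mnm_mdeg (m : 'X_{1..d}) i : (m i <= mdeg m)%N.
Proof. by rewrite mdegE (bigD1 i)//= leq_addr. Qed.

Lemma card_mdeg_le b n : (n < b)%N ->
  #|[pred m : 'X_{1..d < b} | (mdeg m <= n)%N]| = 'C(d + n, d).
Proof.
move=> ltnb; rewrite -card_partial_ord_partitions.
pose f (m : 'X_{1..d < b}) : d.-tuple 'I_n.+1 := [tuple inord (m i) | i < d].
have fE (m : 'X_{1..d < b}) i : (mdeg m <= n)%N -> tnth (f m) i = m i :> nat.
  move=> mn; rewrite tnth_mktuple inordK// ltnS.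
  exact: leq_trans (leq_mnm_mdeg _ _) mn.
rewrite -(card_in_imset (f := f)) => [|m m' mn m'n ff]; last first.
  by apply/val_inj/mnmP => i; rewrite -!fE// ff.
apply: eq_card => t; apply/imsetP/idP => [[m mn ->]|].
  rewrite inE big_tuple; under eq_bigr do rewrite fE//.
  by rewrite -mdegE.
rewrite inE big_tuple => tn.
have mt : mdeg [multinom (tnth t i : nat) | i < d] = (\sum_i tnth t i)%N.
  by rewrite mdegE; apply: eq_bigr => i _; rewrite mnmE.
have ltb : (mdeg [multinom (tnth t i : nat) | i < d] < b)%N.
  by rewrite mt (leq_ltn_trans tn).
have mn : (mdeg (BMultinom ltb) <= n)%N by rewrite /= mt.
exists (BMultinom ltb) => //.
by apply/eq_from_tnth => i; apply: ord_inj; rewrite fE//= mnmE.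
Qed.

(** Such a monomial amounts to the tuple of its last [d - c] exponents, of sum
  [n]. *)
Lemma card_mdeg_eq_tail b c n : (c < d)%N -> (n < b)%N ->
  #|[pred m : 'X_{1..d < b} | (mdeg m == n) &&
      [forall i : 'I_d, (i < c)%N ==> (m i == 0%N)]]| =
  'C(n + (d - c.+1), d - c.+1).
Proof.
move=> ltcd ltnb; rewrite addnC -card_ord_partitions.
set e := (d - c.+1)%N.
have rP (i : 'I_e.+1) : (c + i < d)%N by have := ltn_ord i; lia.
pose r i := Ordinal (rP i).
pose f (m : 'X_{1..d < b}) : e.+1.-tuple 'I_n.+1 :=
  [tuple inord (m (r i)) | i < e.+1].
have mdegT (m : 'X_{1..d}) : (forall i : 'I_d, (i < c)%N -> m i = 0%N) ->
    mdeg m = (\sum_i m (r i))%N.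
  move=> m0; rewrite mdegE (bigID (fun i : 'I_d => (i < c)%N)) /= big1 ?add0n//.
  rewrite (reindex_onto r (fun i => inord (i - c))) /= => [|i nic]; last first.
    by apply: val_inj; rewrite /= inordK; have := ltn_ord i; lia.
  apply: eq_bigl => i; rewrite -leqNgt leq_addr /=; apply/eqP/val_inj.
  by rewrite /= inordK; have := ltn_ord i; lia.
have zeroP (m : 'X_{1..d}) :
    reflect (forall i : 'I_d, (i < c)%N -> m i = 0%N)
      [forall i : 'I_d, (i < c)%N ==> (m i == 0%N)].
  by apply: (iffP forallP) => m0 i; [move=> ic; have /implyP/(_ ic)/eqP := m0 i
    | apply/implyP => /m0 ->].
have fE (m : 'X_{1..d < b}) i : mdeg m = n -> tnth (f m) i = m (r i) :> nat.
  move=> mn; rewrite tnth_mktuple inordK// ltnS -mn.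
  exact: leq_mnm_mdeg.
rewrite -(card_in_imset (f := f)) => [|m m' /andP[/eqP mn /zeroP m0]]; last first.
  move=> /andP[/eqP m'n /zeroP m'0] ff; apply/val_inj/mnmP => i.
  have [ic|ci] := ltnP i c; first by rewrite m0// m'0.
  have [j ->] : exists j, i = r j.
    have lt : (i - c < e.+1)%N by have := ltn_ord i; lia.
    by exists (Ordinal lt); apply: val_inj; rewrite /= subnKC.
  by rewrite -!fE// ff.
apply: eq_card => t; apply/imsetP/idP => [[m /andP[/eqP mn /zeroP m0] ->]|].
  rewrite inE big_tuple; under eq_bigr do rewrite fE//.
  by rewrite -mdegT// mn.
rewrite inE big_tuple => /eqP tn.
pose m := [multinom (if (i < c)%N then 0%N else tnth t (inord (i - c)))
  | i < d].
have m0 (i : 'I_d) : (i < c)%N -> m i = 0%N by move=> ic; rewrite mnmE ic.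
have mr i : m (r i) = tnth t i.
  rewrite mnmE ltnNge leq_addr /=; congr (nat_of_ord (tnth t _)).
  by apply: val_inj; rewrite /= addKn inord_val.
have mn : mdeg m = n by rewrite mdegT// -[RHS]tn; apply: eq_bigr => i _.
have ltb : (mdeg m < b)%N by rewrite mn.
exists (BMultinom ltb); first by rewrite inE /= mn eqxx; apply/zeroP.
by apply/eq_from_tnth => i; apply: ord_inj; rewrite fE//= mr.
Qed.

End CountMonomials.

Lemma big_option (T : finType) (f : option T -> nat) :
  (\sum_k f k = f None + \sum_t f (Some t))%N.
Proof.
rewrite (bigD1 None)//=; congr (_ + _)%N.
rewrite (reindex_omap Some id) => [|[]//].
by apply: eq_bigl => t; rewrite eqxx.
Qed.

Lemma card_pair_pred (T T' : finType) (P : T -> pred T') :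
  #|[pred x : T * T' | P x.1 x.2]| = (\sum_k #|P k|)%N.
Proof.
rewrite -sum1_card; under [RHS]eq_bigr do rewrite -sum1_card.
by rewrite pair_big_dep; apply: eq_bigl => -[].
Qed.

(** * The example *)

Section Example.
Variables (F : numFieldType) (c d : nat) (le_cd : (c <= d)%N).
Local Notation poly := {mpoly F[d]}.
Local Notation idx := (option (option 'I_c)).
Local Notation iy := (Some None).
Local Notation ig i := (Some (Some i)).
Local Notation var i := (widen_ord le_cd i).

Definition wvar (i : 'I_c) : loc F d := emb 'X_(var i).

Local Notation A := (ext wvar).

Definition inj : {rmorphism poly -> A} :=
  GRing.RMorphism.clone _ _ (inc wvar \o @emb F d) _.

Definition cst : {rmorphism F -> A} :=
  GRing.RMorphism.clone _ _ (inj \o @mpolyC d F) _.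

Lemma injME p (a : A) k : (inj p * a) k = emb p * a k.
Proof. exact: incME. Qed.

Lemma injE p k : inj p k = if k is None then emb p else 0.
Proof. by rewrite ffunE. Qed.

Lemma inj_unit p : p@_0%MM != 0 -> exists v, inj p * v = 1.
Proof. by move=> /emb_unit[s ps]; apply: (@ext_unit _ _ _ _ s); rewrite injE. Qed.

(** ** Ideals with monomial components *)

Implicit Types S : idx -> {pred 'X_{1..d}}.

(** A family [S] gives the exponents of the monomials allowed in each component;
  [admissible] families are those for which this defines an ideal. *)
Definition monset S : set A := coordset (fun k => monideal (F := F) (S k)).

Definition admissible S := [/\ forall k, upclosed (S k),
  forall k, {subset S None <= S k} &
  forall i m, m \in S (ig i) -> (U_(var i) + m)%MM \in S iy].

Lemma monidealXM (S S' : {pred 'X_{1..d}}) m (r : loc F d) :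
  (forall m', m' \in S -> (m + m')%MM \in S') ->
  monideal S r -> monideal S' (emb 'X_[m] * r).
Proof.
move=> SS'; apply: (@monidealM _ _ (pred1 m)) => [m' m'' /eqP ->|]; first exact: SS'.
exists 'X_[m], 1; rewrite mcoeff1 eqxx oner_neq0 emb1 mulr1; split=> // m'.
by rewrite msuppX inE.
Qed.

Lemma monset_ideal S : admissible S -> ideal (monset S).
Proof.
case=> uS SN Sw; apply: coordset_ideal => [k|k|i r].
- exact: monideal_ideal.
- exact: monideal_sub.
by apply: monidealXM => m; apply: Sw.
Qed.

Lemma monset_gen S (V : set A) : ideal V ->
  (forall k m, m \in S k -> V (inj 'X_[m] * bas wvar k)) -> monset S `<=` V.
Proof.
move=> iV SV a Sa; rewrite [a]ext_basis; apply: ideal_sum => // k _.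
apply: (@monideal_gen _ _ (S k) [set r | V (inc wvar r * bas wvar k)]) (Sa k).
  apply/idealP; split=> [|r s|r s] /=.
  - by rewrite rmorph0 mul0r; apply: ideal0.
  - by rewrite rmorphD mulrDl; apply: idealD.
  by rewrite rmorphM -mulrA; apply: idealMl.
by move=> m /SV.
Qed.

Lemma monsetX S m k : (forall k, upclosed (S k)) ->
  m \in S k -> monset S (inj 'X_[m] * bas wvar k).
Proof.
move=> uS mS l; rewrite injME basE; have iS := @monideal_ideal F d _ (uS l).
have [->|_] := eqVneq l k; last by rewrite mulr0; apply: ideal0.
by rewrite mulr1; apply/monidealX.
Qed.

Lemma monset_sub S S' : (forall k, {subset S k <= S' k}) ->
  monset S `<=` monset S'.
Proof. by move=> SS' a Sa k; apply: monideal_sub (Sa k). Qed.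

(** The component along [y] of [I ^ n]: besides the monomials of degree at least
  [n], it has the products of [n.-2] variables with [g i * g i = z i * y]. *)
Definition low n : {pred 'X_{1..d}} := [pred m : 'X_{1..d} | (n <= mdeg m)%N
  || (n <= (mdeg m).+1)%N && [exists i : 'I_c, m (var i) != 0%N]].

(** The components of [I ^ n]; since [g i] is in [I], those along the [g i] lose
  one degree. *)
Definition pw n (k : idx) : {pred 'X_{1..d}} :=
  match k with None => degge n | iy => low n | ig _ => degge n.-1 end.

Lemma mnm_varD (m m' : 'X_{1..d}) : [exists i : 'I_c, m (var i) != 0%N] ->
  [exists i : 'I_c, (m + m')%MM (var i) != 0%N].
Proof.
case/existsP=> i mi; apply/existsP; exists i.
by rewrite mnmDE addn_eq0 negb_and mi.
Qed.

Lemma mnm_varU i (m : 'X_{1..d}) : [exists j : 'I_c, (U_(var i) + m)%MM (var j) != 0%N].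
Proof. by apply/existsP; exists i; rewrite mnmDE mnm1E eqxx. Qed.

Lemma low_upclosed n : upclosed (low n).
Proof.
move=> m m' /orP[nm|/andP[nm mi]]; apply/orP.
  by left; rewrite mdegD (leq_trans nm)// leq_addr.
by right; rewrite mnm_varD// mdegD andbT (leq_trans nm)// ltnS leq_addr.
Qed.

Lemma pw_admissible n : admissible (pw n).
Proof.
split=> [[[i|]|]|[[i|]|] m|i m].
- exact: degge_upclosed.
- exact: low_upclosed.
- exact: degge_upclosed.
- by rewrite !inE; apply: leq_trans; rewrite leq_pred.
- by rewrite !inE => ->.
- by [].
rewrite !inE mnm_varU andbT mdegD mdeg1 add1n => nm; apply/orP; right.
by rewrite (leq_trans (leqSpred n)) // ltnS (leq_trans nm).
Qed.

Definition idI : set A := monset (pw 1).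

Lemma low1 m : m \in low 1 -> (0 < mdeg m)%N.
Proof.
rewrite inE => /orP[//|/andP[_ /existsP[i mi]]].
by rewrite lt0n mdeg_eq0; apply: contraNneq mi => ->; rewrite mnm0E.
Qed.

Lemma low_deg n m : m \in low n -> (n <= (mdeg m).+1)%N.
Proof. by rewrite inE => /orP[/leqW|/andP[]]. Qed.

Lemma monset_pwS n (a b : A) : (0 < n)%N ->
  idI a -> monset (pw n) b -> monset (pw n.+1) (a * b).
Proof.
move=> n0 Ia Ib; have [upw _ _] := pw_admissible n.+1.
have iS k := @monideal_ideal F d _ (upw k).
case=> [[i|]|].
- rewrite mulgE; apply: idealD; first exact: iS.
    apply: monidealM (Ia None) (Ib (ig i)) => m m'; rewrite !inE mdegD.
    by lia.
  apply: monidealM (Ia (ig i)) (Ib None) => m m'; rewrite !inE mdegD /= => _ nm.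
  exact: leq_trans nm (leq_addl _ _).
- rewrite mulyE; apply: idealD; [exact: (iS iy)|apply: idealD; first exact: (iS iy)|].
  + apply: monidealM (Ia None) (Ib iy) => m m'; rewrite !inE mdegD => m1.
    case/orP=> [nm|/andP[nm mi]]; apply/orP.
      by left; rewrite -add1n leq_add.
    right; rewrite addmC mnm_varD// andbT -addnS -[n.+1]add1n.
    exact: leq_add.
  + apply: monidealM (Ia iy) (Ib None) => m m' /low1 m1; rewrite !inE => nm.
    by rewrite mdegD; lia.
  apply: ideal_sum => [|i _]; first exact: (iS iy).
  apply: (@monidealXM (degge n.-1)) => [m|].
    rewrite !inE mnm_varU andbT mdegD mdeg1 add1n => nm; apply/orP; right.
    by lia.
  apply: monidealM (Ia (ig i)) (Ib (ig i)) => m m'; rewrite !inE mdegD => _ nm.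
  exact: leq_trans nm (leq_addl _ _).
rewrite mulNE; apply: monidealM (Ia None) (Ib None) => m m'.
by rewrite !inE mdegD -[n.+1]add1n; apply: leq_add.
Qed.

Lemma mnm_split_var (m : 'X_{1..d}) i :
  m i != 0%N -> m = (U_(i) + (m - U_(i)))%MM.
Proof. by move=> mi; rewrite addmC submK// lep1mP. Qed.

Lemma mnm_split_deg (m : 'X_{1..d}) : (0 < mdeg m)%N ->
  exists i m', m = (U_(i) + m')%MM.
Proof.
rewrite lt0n mdeg_eq0 => m0; have [i mi] : exists i, m i != 0%N.
  apply: contrapT => /forallNP mE; case/eqP: m0; apply/mnmP => i.
  by rewrite mnm0E; apply/eqP; rewrite -[_ == _]negbK; apply/negP/mE.
by exists i, (m - U_(i))%MM; apply: mnm_split_var.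
Qed.

(** The variables and the [g i] are in [I] and can be split off, except from the
  monomials of degree [n] along [y]: these use the relation
  [z i * y = g i * g i]. *)
Lemma mul_idI_pw n : (0 < n)%N -> ideal_mul idI (monset (pw n)) = monset (pw n.+1).
Proof.
move=> n0; have adm := pw_admissible; have upw n' : forall k, upclosed (pw n' k).
  by case: (adm n').
have iI : ideal idI by apply/monset_ideal/adm.
have iIn := ideal_mul_ideal (monset (pw n)) iI.
apply/seteqP; split.
  apply: ideal_mul_min; first exact/monset_ideal/adm.
  by move=> u v; apply: monset_pwS.
have Ivar i : idI (inj 'X_i).
  by rewrite -[inj _]mulr1 -basN; apply: monsetX; rewrite // inE mdeg1.
have Ig i : idI (bas wvar (ig i)).
  by rewrite -[bas _ _]mul1r -(rmorph1 inj) -mpolyX0; apply: monsetX.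
have deg k m : (forall i m', m = (U_(i) + m')%MM -> m' \in pw n k) ->
    (0 < mdeg m)%N -> ideal_mul idI (monset (pw n)) (inj 'X_[m] * bas wvar k).
  move=> mk /mnm_split_deg[i [m' Em]]; rewrite Em mpolyXD rmorphM -mulrA.
  by apply: mem_ideal_mul => //; apply: monsetX => //; apply: (mk i).
apply: monset_gen => // -[[i|]|] m.
- rewrite mulrC => mn; apply: mem_ideal_mul => //.
  by rewrite -[inj _]mulr1 -basN; apply: monsetX.
- case/orP=> [nm|/andP[nm /existsP[i mi]]].
    apply: deg => [i m' Em|]; last exact: leq_trans nm.
    by rewrite inE; apply/orP; left; move: nm; rewrite Em mdegD mdeg1 add1n ltnS.
  rewrite (mnm_split_var mi) mpolyXD rmorphM -mulrA mulrCA.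
  have -> : inj 'X_(var i) * bas wvar iy = bas wvar (ig i) * bas wvar (ig i).
    by rewrite bas_g_sqr.
  rewrite mulrCA; apply: mem_ideal_mul => //; apply: monsetX => //.
  rewrite inE; move: nm; rewrite {1}(mnm_split_var mi) mdegD mdeg1 add1n ltnS.
  by move=> nm; rewrite -ltnS (leq_trans _ nm)// prednK.
move=> nm; apply: deg; last exact: leq_trans nm.
by move=> i m' Em; move: nm; rewrite Em !inE mdegD mdeg1 add1n ltnS.
Qed.

Lemma idI_exp n : ideal_exp idI n.+1 = monset (pw n.+1).
Proof.
have iI : ideal idI by apply/monset_ideal/pw_admissible.
elim: n => [|n IH]; last by rewrite /ideal_exp iterS -/(ideal_exp _ _) IH mul_idI_pw.
apply/seteqP; split=> [|a Ia].
  by apply: ideal_mul_min => // u v Iu _; apply: (@idealMr _ idI).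
by rewrite -[a]mulr1; apply: mem_ideal_mul.
Qed.

(** ** The reduction *)

Definition zs : d.-tuple A := [tuple inj 'X_i | i < d].

Lemma mem_zs i : inj 'X_i \in zs.
Proof. by apply/tnthP; exists i; rewrite tnth_mktuple. Qed.

Lemma zsP x : x \in zs -> exists i, x = inj 'X_i.
Proof. by case/tnthP=> i ->; exists i; rewrite tnth_mktuple. Qed.

Lemma mul_zs S S' : admissible S -> admissible S' ->
  (forall k i m, m \in S k -> (U_(i) + m)%MM \in S' k) ->
  (forall k m, m \in S' k -> exists i m', m = (U_(i) + m')%MM /\ m' \in S k) ->
  ideal_mul (generated zs) (monset S) = monset S'.
Proof.
move=> aS aS' SS' S'S; have [uS _ _] := aS.
have iS' := monset_ideal aS'.
have iG := generated_ideal zs.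
have iQS := ideal_mul_ideal (monset S) iG.
apply/seteqP; split.
  apply: ideal_mul_min => // u v Qu Sv.
  suff : generated zs `<=` [set u | monset S' (u * v)] by apply.
  apply: generated_min => [|x /zsP[i ->] k].
    apply/idealP; split=> [|x y|x y] /=.
    - by rewrite mul0r; apply: ideal0.
    - by rewrite mulrDl; apply: idealD.
    by rewrite -mulrA; apply: idealMl.
  by rewrite injME; apply: monidealXM (Sv k) => m; apply: SS'.
apply: monset_gen => // k m /S'S[i [m' [-> m'S]]].
rewrite mpolyXD rmorphM -mulrA; apply: mem_ideal_mul; last exact: monsetX.
exact/mem_generated/mem_zs.
Qed.

(** In [I ^ 3], a monomial along [y] of degree 2 with a factor [z i], [i < c], has
  another variable to be split off, and the quotient still contains [z i]. *)
Lemma zs_reduction : reduction (generated zs) idI.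
Proof.
have adm := pw_admissible; split; first exact: generated_ideal.
  apply: generated_min; first exact/monset_ideal/adm.
  move=> x /zsP[i ->]; rewrite -[inj _]mulr1 -basN; apply: monsetX.
    by case: (adm 1%N).
  by rewrite inE mdeg1.
exists 2%N; rewrite !idI_exp; apply/esym/mul_zs => // [[[j|]|] i m|[[j|]|] m].
- by rewrite !inE mdegD mdeg1.
- rewrite !inE mdegD mdeg1 add1n !ltnS => /orP[->//|/andP[-> mj]].
  by rewrite addmC mnm_varD ?orbT.
- by rewrite !inE mdegD mdeg1.
- move=> mn; have [i [m' Em]] := mnm_split_deg (ltnW mn).
  by exists i, m'; split=> //; move: mn; rewrite Em !inE mdegD mdeg1.
- case/orP=> [nm|/andP[nm /existsP[j mj]]].
    have [i [m' Em]] := mnm_split_deg (leq_trans (isT : (0 < 3)%N) nm).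
    exists i, m'; split=> //; move: nm; rewrite Em mdegD mdeg1 inE.
    by rewrite add1n ltnS => ->.
  have Em := mnm_split_var mj; set m1 := (m - _)%MM in Em.
  have [|i [m' Em1]] := @mnm_split_deg m1.
    by move: nm; rewrite Em mdegD mdeg1.
  exists i, (U_(var j) + m')%MM; split.
    by rewrite Em Em1 !addmA [(U_(i) + _)%MM]addmC.
  by rewrite inE mnm_varU mdegD mdeg1 orbT.
move=> mn; have [i [m' Em]] := mnm_split_deg (leq_trans (isT : (0 < 3)%N) mn).
by exists i, m'; split=> //; move: mn; rewrite Em !inE mdegD mdeg1.
Qed.

(** The components of [Q * I]. *)
Definition qi (k : idx) : {pred 'X_{1..d}} :=
  if k is ig _ then degge 1 else degge 2.

Lemma qi_admissible : admissible qi.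
Proof.
split=> [[[i|]|]|[[i|]|] m|i m]; try exact: degge_upclosed; rewrite //=.
  by rewrite !inE => /ltnW.
by rewrite !inE mdegD mdeg1.
Qed.

Lemma zs_mul_idI : ideal_mul (generated zs) idI = monset qi.
Proof.
apply: mul_zs => [|||]; [exact: pw_admissible|exact: qi_admissible| |].
  by case=> [[j|]|] i m; rewrite ?inE ?mdegD ?mdeg1// => /low1.
move=> k m mn; have [|i [m' Em]] := @mnm_split_deg m.
  by case: k mn => [[j|]|]; apply: leq_trans.
exists i, m'; split=> //; move: k mn.
by case=> [[j|]|]; rewrite Em !inE mdegD mdeg1 add1n ltnS // => ->.
Qed.

(** ** The maximal ideal *)

Definition maxid : set A := [set a | monideal (degge 1) (a None)].

Lemma maxid_ideal : ideal maxid.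
Proof.
have iN := @monideal_ideal F d _ (@degge_upclosed d 1).
apply/idealP; split=> [|a b|b a]; rewrite /maxid /= ?mulNE ?ffunE.
- exact: ideal0.
- exact: idealD.
exact: idealMl.
Qed.

Lemma maxid1 : ~ maxid 1.
Proof.
rewrite /maxid /= oneE eqxx -emb1 -mpolyX0.
by move/monidealX => /(_ (@degge_upclosed d 1)); rewrite degge1E eqxx.
Qed.

Lemma maxid_unit a : ~ maxid a -> exists b, a * b = 1.
Proof. by move=> /degge1_unit[s]; apply: ext_unit. Qed.

Lemma maxid_local : local_ring maxid.
Proof.
by apply: local_ring_units; [exact: maxid_ideal|exact: maxid1|exact: maxid_unit].
Qed.

Lemma cstE t : cst t = inj t%:MP. Proof. by []. Qed.

Lemma maxid_residue a : exists t, maxid (a - cst t).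
Proof.
have [t at0] := residue_const (a None); exists t.
by rewrite /maxid /= !ffunE.
Qed.

Lemma maxid_cst t : maxid (cst t) -> t = 0.
Proof.
move=> mt; have : monideal (degge 1) (inj t%:MP None) := mt.
rewrite injE => /(mem_monideal _ (@degge_upclosed d 1)) {}mt.
apply/eqP; rewrite -[_ == _]negbK; apply/negP => t0.
have /mt : 0%MM \in msupp t%:MP_[d].
  by rewrite mcoeff_msupp mcoeffC eqxx mulr1.
by rewrite degge1E eqxx.
Qed.

Lemma maxid_cosets : infinite_set (cosets maxid).
Proof.
have m0 := ideal0 maxid_ideal.
pose f (n : nat) : set A := [set b | maxid (b - cst n%:R)].
have finj : injective f.
  move=> n n' ff; have : f n (cst n%:R) by rewrite /f /mkset subrr.
  rewrite ff /f /mkset -rmorphB => /maxid_cst /eqP; rewrite subr_eq0 eqr_nat.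
  by move/eqP.
move=> /(finite_preimage (f := f)) fin; apply: infinite_nat.
apply: sub_finite_set (fin _) => [n _|]; last by move=> n n' _ _ /finj.
by exists (cst n%:R).
Qed.

Lemma maxidM a b : maxid a -> maxid b -> idI (a * b).
Proof.
move=> ma mb; have [upw _ _] := pw_admissible 1.
have iN := @monideal_ideal F d _ (@degge_upclosed d 1).
have iy1 := @monideal_ideal F d _ (@low_upclosed 1).
have iL : monideal (degge 1) `<=` monideal (F := F) (low 1).
  by apply: monideal_sub => m; rewrite !inE => ->.
case=> [[i|]|].
- have [p [q [q0 abq]]] := loc_frac ((a * b) (ig i)).
  by exists p, q; split.
- rewrite mulyE; apply: (idealD iy1); [apply: (idealD iy1)|].
  + by apply: idealMr => //; apply: iL.
  + by apply: idealMl => //; apply: iL.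
  apply: ideal_sum => [|i _]; first exact: iy1.
  apply: (@monidealXM predT) => [m _|].
    by rewrite inE mdegD mdeg1.
  have [p [q [q0 abq]]] := loc_frac (a (ig i) * b (ig i)).
  by exists p, q; split.
by rewrite mulNE; apply: idealMl.
Qed.

Lemma idI_sub_maxid : idI `<=` maxid.
Proof. by move=> a /(_ None). Qed.

(** A power of [maxid] is contained in each power of [I], because [maxid ^ 2] is
  contained in [I]. *)
Lemma maxid_prod n s : size s = n.+1.*2 -> (forall x, x \in s -> maxid x) ->
  monset (pw n.+1) (\prod_(x <- s) x).
Proof.
elim: n s => [|n IH] [|x [|y s]]//=.
  case: s => // _ sm; rewrite !big_cons big_nil mulr1.
  by apply: maxidM; apply: sm; rewrite !inE eqxx ?orbT.
case=> ss sm; rewrite !big_cons mulrA; apply: monset_pwS => //.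
  by apply: maxidM; apply: sm; rewrite !inE eqxx ?orbT.
by apply: IH => // z zs; apply: sm; rewrite !inE zs !orbT.
Qed.

Lemma idI_primary : primary_to maxid idI.
Proof.
have iI : ideal idI by apply/monset_ideal/pw_admissible.
have sqI x : maxid x -> idI (x ^+ 2) by move=> mx; rewrite expr2; apply: maxidM.
split.
  split; first by apply/proper_idlP; split=> // /idI_sub_maxid/maxid1.
  move=> x y Ixy; have [my|/maxid_unit[z yz]] := pselect (maxid y).
    by right; exists 2%N; apply: sqI.
  by left; apply: (ideal_unitM iI yz); rewrite mulrC.
apply/seteqP; split=> [x [n /idI_sub_maxid mxn]|x mx]; last first.
  by exists 2%N; apply: sqI.
apply: contrapT => /maxid_unit[z xz]; apply: maxid1.
by rewrite -(expr1n _ n) -xz exprMn; apply: idealMr => //; exact: maxid_ideal.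
Qed.

(** ** Lengths *)

Section MonsetLength.
Variables (S S' : idx -> {pred 'X_{1..d}}) (n : nat).

Definition between (k : idx) : pred 'X_{1..d < n} :=
  fun m => ((m : 'X_{1..d}) \in S' k) && ((m : 'X_{1..d}) \notin S k).

Let D := [pred km : idx * 'X_{1..d < n} | between km.1 km.2].

Let e (km : idx * 'X_{1..d < n}) : A :=
  inj 'X_[(km.2 : 'X_{1..d})] * bas wvar km.1.

Lemma sum_between (g : idx * 'X_{1..d < n} -> loc F d) k :
  (\sum_(km in D) inc wvar (g km) * bas wvar km.1) k =
  \sum_(m | between k m) g (k, m).
Proof.
transitivity ((\sum_l \sum_(m | between l m) inc wvar (g (l, m)) * bas wvar l) k).
  congr ((_ : A) k); rewrite pair_big_dep /=; apply: eq_bigr.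
  by case.
rewrite ext_sumE (bigD1 k)//= [X in _ + X]big1 ?addr0.
  by rewrite ext_sumE; apply: eq_bigr => m _; rewrite incME basE eqxx mulr1.
move=> l lk; rewrite ext_sumE big1// => m _.
by rewrite incME basE eq_sym (negbTE lk) mulr0.
Qed.

Lemma monset_combE (a : idx * 'X_{1..d < n} -> F) k :
  (\sum_(km in D) cst (a km) * e km) k =
  emb (\sum_(m | between k m) a (k, m) *: 'X_[(m : 'X_{1..d})]).
Proof.
rewrite rmorph_sum -(sum_between (fun km => emb (a km *: 'X_[(km.2 : 'X_{1..d})]))).
congr ((_ : A) k); apply: eq_bigr => km _.
by rewrite -mul_mpolyC embM rmorphM -mulrA.
Qed.

Lemma monset_length N : admissible S -> admissible S' ->
  (forall k, {subset S k <= S' k}) ->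
  (forall k m, (n <= mdeg m)%N -> m \in S k) ->
  (forall s x, size s = N -> (forall y, y \in s -> maxid y) -> monset S' x ->
     monset S (\prod_(y <- s) y * x)) ->
  quot_length (monset S') (monset S) #|D|.
Proof.
move=> aS aS' SS' Sn nil; have [uS _ _] := aS; have [uS' _ _] := aS'.
apply: (quot_length_basis (k := cst) (e := e) _ _ _ maxid_residue nil).
- exact: monset_ideal.
- exact: monset_ideal.
- exact: monset_sub.
- by case=> k m /andP[mS' _]; apply: monsetX.
- move=> a Sa [k m] Dkm; have := Sa k; rewrite monset_combE mem_monideal//.
  move=> suppS; apply/eqP; apply: contraT => akm.
  have {}Dkm : between k m := Dkm; have /andP[_] := Dkm.
  case/negP; apply: suppS; rewrite mcoeff_msupp raddf_sum (bigD1 m)//=.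
  rewrite mcoeffZ mcoeffX eqxx mulr1 big1 ?addr0// => m' /andP[_ m'm].
  by rewrite mcoeffZ mcoeffX -bmeqP (negbTE m'm) mulr0.
move=> x S'x.
have /choice[p pP] k : exists p, {subset msupp p <= [predC S k]} /\
    monideal (S k) (x k - emb p).
  exact: monideal_spanned (uS k) (Sn k).
exists (fun km : idx * 'X_{1..d < n} => (p km.1)@_(km.2 : 'X_{1..d})) => k.
have [suppS Sxp] := pP k.
suff Ep : p k = \sum_(m | between k m) (p k)@_m *: 'X_[(m : 'X_{1..d})].
  by rewrite ffunE ffunE monset_combE -Ep.
have szp : (msize (p k) <= n)%N.
  rewrite msizeE; apply/bigmax_leqP_seq => m mp _; rewrite ltnNge.
  by apply: contra (suppS m mp) => /Sn.
rewrite [LHS](mpolywE szp) [RHS]big_mkcond /=; apply: eq_bigr => m _.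
rewrite /between; have [mp|/memN_msupp_eq0 ->] := boolP (val m \in msupp (p k)).
  have mS : val m \notin S k by exact: suppS.
  suff -> : val m \in S' k by rewrite mS.
  have S'p : monideal (S' k) (emb (p k)).
    have iS' := @monideal_ideal F d _ (uS' k).
    have -> : emb (p k) = x k - (x k - emb (p k)) by rewrite opprB addrC subrK.
    by apply: idealB => //; apply: monideal_sub Sxp.
  by move/mem_monideal: S'p => /(_ (uS' k)); apply.
by rewrite scale0r if_same.
Qed.

End MonsetLength.

Lemma monsetT : monset (fun=> predT) = setT.
Proof.
apply/seteqP; split=> // a _ k; have [p [q [q0 aq]]] := loc_frac (a k).
by exists p, q.
Qed.

Lemma length_pw n : quot_length setT (monset (pw n.+1))
  (\sum_k #|between (pw n.+1) (fun=> predT) (n := n.+1) k|).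
Proof.
rewrite -monsetT -card_pair_pred.
apply: (monset_length (N := n.+1.*2)) => //.
- exact: pw_admissible.
- by move=> [[i|]|] m nm; rewrite inE ?nm //; apply: ltnW.
move=> s x ss sm _; apply: (@idealMr _ (monset (pw n.+1))).
   exact/monset_ideal/pw_admissible.
exact: maxid_prod.
Qed.

(** The basis of [A/I ^ n.+1] consists of the monomials of degree at most [n],
  of their products of degree at most [n] with the [g i], the latter counted
  with degree [1], and of the products with [y] of the monomials of degree less
  than [n] and of those of degree [n] in the last [d - c] variables. *)
Definition len n : nat :=
  ('C(d + n, d) + ('C(d + n.-1, d) +
    (if (c < d)%N then 'C(n + (d - c.+1), d - c.+1) else 0) +
    c * 'C(d + n.-1, d)))%N.

Lemma tailP (m : 'X_{1..d}) : [forall i : 'I_d, (i < c)%N ==> (m i == 0%N)] =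
  ~~ [exists i : 'I_c, m (var i) != 0%N].
Proof.
apply/forallP/existsPn => m0 i; last first.
  apply/implyP => ic; have := m0 (Ordinal ic); rewrite negbK => /eqP <-.
  by apply/eqP; congr (m _); apply: val_inj.
by rewrite negbK; have /implyP := m0 (var i); apply; rewrite /= ltn_ord.
Qed.

Lemma notin_degge n (m : 'X_{1..d}) : (m \notin degge n) = (mdeg m < n)%N.
Proof. by rewrite ltnNge. Qed.

Lemma betweenT b S k (m : 'X_{1..d < b}) :
  (m \in between S (fun=> predT) k) = ((m : 'X_{1..d}) \notin S k).
Proof. by []. Qed.

Lemma length_idI n : (0 < n)%N ->
  quot_length setT (ideal_exp idI n.+1) (len n).
Proof.
move=> n0; rewrite idI_exp.
suff -> : len n = (\sum_k #|between (pw n.+1) (fun=> predT) (n := n.+1) k|)%N.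
  exact: length_pw.
rewrite !big_option /len; congr (_ + _)%N.
  rewrite -(card_mdeg_le d (leqnn n.+1)); apply: eq_card => m.
  by rewrite betweenT notin_degge ltnS.
have low_le : #|[pred m : 'X_{1..d < n.+1} | (mdeg m <= n.-1)%N]| = 'C(d + n.-1, d).
  by apply: card_mdeg_le; rewrite ltnS leq_pred.
congr (_ + _)%N; last first.
  rewrite -[c in LHS]card_ord -sum_nat_const; apply: eq_bigr => i _.
  rewrite -low_le; apply: eq_card => m.
  by rewrite betweenT notin_degge [LHS]inE; lia.
rewrite -(cardID [pred m : 'X_{1..d < n.+1} | (mdeg m <= n.-1)%N]) -low_le.
have lowE (m : 'X_{1..d < n.+1}) : (m \in between (pw n.+1) (fun=> predT) iy) =
    ~~ ((n <= mdeg m)%N && [exists i : 'I_c, m (var i) != 0%N]).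
  by rewrite betweenT inE negb_or -ltnNge bmdeg ltnS.
congr (_ + _)%N; first apply: eq_card => m.
  rewrite [LHS]inE [RHS]inE [X in X && _]lowE [X in _ && X]inE.
  have [mn|//] := leqP (mdeg m) n.-1; last by rewrite andbF.
  by rewrite andbT (_ : (n <= mdeg m)%N = false) //; lia.
case: ifP => [ltcd|/negbT]; [|rewrite -leqNgt => ledc; symmetry; apply: eq_card0 => m].
  rewrite -(card_mdeg_eq_tail ltcd (leqnn n.+1)); apply: eq_card => m.
  rewrite [LHS]inE [RHS]inE [X in _ = ~~ X && _]inE [X in _ = _ && X]lowE tailP.
  have := bmdeg m; rewrite ltnS => mn.
  have [->|nm] := eqVneq (mdeg m) n.
    by rewrite leqnn -ltnNge; case: [exists i, _]; lia.
  by rewrite -ltnNge; symmetry; apply/negbTE; rewrite negb_and -leqNgt; lia.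
rewrite inE [X in ~~ X && _]inE [X in _ && X]lowE; apply/negP => /andP[].
rewrite -ltnNge prednK// => nm; rewrite nm /= -tailP => /forallP m0.
have : mdeg m = 0%N.
  rewrite mdegE big1// => i _; apply/eqP; have /implyP := m0 i; apply.
  exact: leq_trans (ltn_ord i) ledc.
lia.
Qed.

Lemma length_A_idI : quot_length setT idI 2.
Proof.
rewrite (_ : 2%N = \sum_k #|between (pw 1) (fun=> predT) (n := 1) k|)%N; first exact: length_pw.
have card1 : #|[pred m : 'X_{1..d < 1} | (mdeg m <= 0)%N]| = 1%N.
  by rewrite card_mdeg_le// addn0 binn.
rewrite !big_option [X in (_ + (_ + X))%N]big1 => [|i _]; last first.
  by apply: eq_card0 => m; rewrite betweenT notin_degge.
rewrite addn0 (_ : 2%N = 1 + 1)%N//; congr (_ + _)%N; rewrite -[LHS]card1; apply: eq_card => m.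
  by rewrite betweenT notin_degge ltnS.
have := bmdeg m; rewrite ltnS leqn0 => /eqP m0.
rewrite betweenT [LHS]inE m0 leqnn; symmetry.
by apply/negP => /low1; rewrite m0.
Qed.

Lemma length_idI2 : quot_length (ideal_exp idI 2) (ideal_mul (generated zs) idI) c.
Proof.
rewrite idI_exp zs_mul_idI.
rewrite [X in quot_length _ _ X](_ : c =
    \sum_k #|between qi (pw 2) (n := 2) k|)%N.
  rewrite -card_pair_pred; apply: (monset_length (N := 2)).
  - exact: qi_admissible.
  - exact: pw_admissible.
  - by case=> [[i|]|] m //; rewrite !inE => ->.
  - by case=> [[i|]|] m //; apply: ltnW.
  move=> s x ss sm Ix; suff : monset (pw 3) (\prod_(y <- s) y * x).
    apply: monset_sub => -[[i|]|] m; rewrite ?inE; [exact: ltnW|move=> /low_deg|exact: ltnW].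
    by rewrite ltnS.
  apply: monset_pwS => //; exact: (@maxid_prod 0).
rewrite !big_option [X in (X + _)%N]eq_card0 => [|m]; last exact: andbN.
rewrite [X in (_ + (_ + X))%N]big1 => [|i _]; last first.
  by apply: eq_card0 => m; apply: andbN.
rewrite add0n addn0; transitivity (\sum_(i < c) 1)%N.
  by rewrite sum_nat_const card_ord muln1.
rewrite sum1_card.
have lt2 (i : 'I_c) : (mdeg (U_(var i)%MM : 'X_{1..d}) < 2)%N by rewrite mdeg1.
pose f i := BMultinom (lt2 i).
have fE i : val (f i) = U_(var i)%MM by [].
have finj : injective f.
  move=> i j /(congr1 val); rewrite !fE => /eqP; rewrite eq_mnm1 => /eqP.
  by move=> /(congr1 val) ij; apply: val_inj.
rewrite -(card_codom finj) ; apply: eq_card => m.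
apply/codomP/andP => [[i ->]|[]].
  by split; rewrite fE !inE mdeg1 //=; apply/existsP; exists i; rewrite mnm1E eqxx.
rewrite !inE -ltnNge => /orP[mge|/andP[m1 /existsP[i mi]]] mlt.
  by move: mlt; rewrite ltnNge mge.
have Em := mnm_split_var mi.
have : (mdeg (m - U_(var i))%MM == 0)%N by move: mlt; rewrite {1}Em mdegD mdeg1; lia.
rewrite mdeg_eq0 => /eqP m0; rewrite m0 addm0 in Em.
by exists i; apply/val_inj.
Qed.

(** ** Hilbert coefficients *)

(** The coefficient of index [c.+1] accounts for the monomials in the last [d - c] variables. *)
Definition hcoef (i : nat) : int :=
  if i == 0%N then (c.+2)%:Z else if i == 1%N then (c.+1)%:Z
  else if i == c.+1 then (-1) ^+ c.+1 else 0.

Lemma hilbert_idI : (0 < c)%N -> hilbert_coefficients d idI hcoef.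
Proof.
move=> c0; exists 1%N => n n0; exists (len n); first exact: length_idI.
have d0 : (0 < d)%N by lia.
rewrite /len.
have binD : 'C(d + n, d) = ('C(d + n.-1, d) + 'C(d + n.-1, d.-1))%N.
  by have := binS (d.-1.+1 + n.-1) d.-1; rewrite -addnS !prednK.
rewrite binD; move: le_cd; rewrite leq_eqVlt => ltcd.
have -> : \sum_(i < d.+1) (-1) ^+ i * hcoef i * ('C(n + d - i, d - i)%N)%:Z =
    (c.+2)%:Z * ('C(n + d, d)%N)%:Z - (c.+1)%:Z * ('C(n + d - 1, d - 1)%N)%:Z
    + (if (c < d)%N then 'C(n + (d - c.+1), d - c.+1) else 0%N)%:Z.
  rewrite big_ord_recl /= mul1r !subn0 -addrA; congr (_ + _).
  rewrite -[in LHS](prednK d0) big_ord_recl /= expr1 mulN1r mulNr.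
  rewrite /bump /= !addn0; congr (_ + _); first by rewrite prednK.
  have zero i : (i : nat).+2 != c.+1 -> hcoef i.+2 = 0.
    by rewrite /hcoef /= => /negbTE ->.
  case: ifP => [cd|/negbT cd].
    have cP : (c.-1 < d.-1)%N by lia.
    rewrite (bigD1 (Ordinal cP))//= big1 ?addr0 => [|i ic].
      have -> : (1 + (1 + c.-1) = c.+1)%N by lia.
      rewrite /hcoef eqxx (_ : (c.+1 == 1)%N = false); last by lia.
      rewrite -exprD addnn -signr_odd odd_double mul1r.
      by congr (Posz 'C(_, _)); lia.
    rewrite !add1n zero ?mulr0 ?mul0r//.
    apply: contra ic => /eqP ic; apply/eqP/val_inj => /=; lia.
  rewrite big1// => i _; rewrite !add1n zero ?mulr0 ?mul0r//.
  by have := ltn_ord i; lia.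
rewrite [(n + d)%N]addnC binD.
have -> : (d + n - 1 = d + n.-1)%N by lia.
by rewrite subn1; lia.
Qed.

(** ** Noetherianity of the example *)

(** The variables, the [g i] and [y] generate a polynomial subalgebra of which
  [A] is a localization. *)
Definition gens (j : 'I_#|{: 'I_d + idx}|) : A :=
  match enum_val j with inl i => inj 'X_i | inr k => bas wvar k end.

Definition present : {rmorphism {mpoly F[#|{: 'I_d + idx}|]} -> A} :=
  GRing.RMorphism.clone _ _ (mmap cst gens) _.

Lemma common_denominator (a : A) : exists (q : poly) (p : idx -> poly),
  q@_0%MM != 0 /\ forall k, emb q * a k = emb (p k).
Proof.
have /choice[q qP] k : exists q : poly, q@_0%MM != 0 /\
    exists p, a k * emb q = emb p.
  by have [p [q [q0 aq]]] := loc_frac (a k); exists q; split=> //; exists p.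
have /choice[p pP] k : exists p, a k * emb (q k) = emb p by case: (qP k).
exists (\prod_k q k), (fun k => p k * \prod_(l | l != k) q l); split=> [|k].
  by rewrite rmorph_prod; apply/prodf_neq0 => k _; case: (qP k).
by rewrite (bigD1 k)//= !embM -pP mulrC mulrA.
Qed.

Lemma ext_common_denominator (a : A) : exists (q : poly) (p : idx -> poly),
  q@_0%MM != 0 /\ inj q * a = \sum_k inj (p k) * bas wvar k.
Proof.
have [q [p [q0 qa]]] := common_denominator a; exists q, p; split=> //.
rewrite [LHS]ext_basis; apply: eq_bigr => k _; congr (_ * _).
by rewrite injME qa.
Qed.

Lemma ext_noetherian : noetherian A.
Proof.
apply: (@noetherian_of_mpoly F _ _ present) => a.
have [q [p [q0 qa]]] := ext_common_denominator a.
have [v qv] := inj_unit q0; exists (inj q), v.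
pose im b := exists P, b = present P.
have imD b b' : im b -> im b' -> im (b + b').
  by move=> [P ->] [P' ->]; exists (P + P'); rewrite rmorphD.
have imM b b' : im b -> im b' -> im (b * b').
  by move=> [P ->] [P' ->]; exists (P * P'); rewrite rmorphM.
have im0 : im 0 by exists 0; rewrite rmorph0.
have im1 : im 1 by exists 1; rewrite rmorph1.
have imc t : im (cst t) by exists t%:MP; rewrite [RHS]mmapC.
have img x : im (match x with inl i => inj 'X_i | inr k => bas wvar k end).
  by exists 'X_(enum_rank x); rewrite [RHS]mmapX mmap1U /gens enum_rankK.
have imp P : im (inj P).
  rewrite [P]mpolyE rmorph_sum; apply: (big_ind im) => // m _.
  rewrite -mul_mpolyC rmorphM; apply: (imM); first exact: imc.
  rewrite mpolyXE_id rmorph_prod; apply: (big_ind im) => // i _.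
  rewrite rmorphXn; elim: (m i) => [//|l IH]; rewrite exprS.
  by apply: (imM) => //; apply: (img (inl i)).
have [P EP] : im (inj q * a).
  rewrite qa; apply: (big_ind im) => // k _; apply: (imM); first exact: imp.
  exact: (img (inr k)).
by exists P.
Qed.

(** ** Growth *)

Definition bounded s (a : A) := forall k, exists p : poly,
  a k = emb p /\ (msize p <= s)%N.

Lemma bounded1 : bounded 1 1.
Proof.
case=> [k|]; first by exists 0; rewrite oneE emb0 msize0.
by exists 1; rewrite oneE emb1 msize1.
Qed.

Lemma boundedW s t (a : A) : (s <= t)%N -> bounded s a -> bounded t a.
Proof. by move=> st ba k; have [p [? /leq_trans]] := ba k; exists p; split; auto. Qed.

Lemma msizeM_leq (p q : poly) s t : (msize p <= s)%N -> (msize q <= t)%N ->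
  (msize (p * q)%R <= (s + t).-1)%N.
Proof.
move=> ps qt; have [->|p0] := eqVneq p 0; first by rewrite mul0r msize0.
have [->|q0] := eqVneq q 0; first by rewrite mulr0 msize0.
by rewrite msizeM// -!subn1 leq_sub2r// leq_add.
Qed.

Lemma msizeD_leq (p q : poly) s : (msize p <= s)%N -> (msize q <= s)%N ->
  (msize (p + q)%R <= s)%N.
Proof. by move=> ps qs; have := msizeD_le p q; lia. Qed.

(** As [msize] exceeds the degree by one, the factor [z i] of the product of two
  vectors [g i] is absorbed. *)
Lemma boundedM s t (a b : A) : (0 < s)%N -> bounded s a -> bounded t b ->
  bounded (s + t) (a * b).
Proof.
move=> s0 /choice[p pP] /choice[q qP] k.
have szM k1 k2 : (msize (p k1 * q k2)%R <= (s + t).-1)%N.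
  by apply: msizeM_leq; [case: (pP k1)|case: (qP k2)].
have aE l : a l = emb (p l) by case: (pP l).
have bE l : b l = emb (q l) by case: (qP l).
case: k => [[i|]|].
- exists (p None * q (ig i) + p (ig i) * q None); split.
    by rewrite mulgE embD !embM !aE !bE.
  by apply: msizeD_leq; apply: leq_trans (leq_pred _).
- exists (p None * q iy + p iy * q None +
    \sum_i 'X_(var i) * (p (ig i) * q (ig i))); split.
    rewrite mulyE !embD !embM !aE !bE; congr (_ + _).
    rewrite [RHS]rmorph_sum; apply: eq_bigr => i _.
    by rewrite aE bE /wvar -!embM.
  apply: msizeD_leq; first by apply: msizeD_leq; apply: leq_trans (leq_pred _).
  apply: (big_ind (fun P : poly => (msize P <= s + t)%N)) => [|P Q|i _].
  + by rewrite msize0.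
  + exact: msizeD_leq.
  have := msizeM_leq (leqnn (msize ('X_(var i) : poly))) (szM (ig i) (ig i)).
  by rewrite msizeX mdeg1 /= add1n prednK// addn_gt0 s0.
exists (p None * q None); split; first by rewrite mulNE embM aE bE.
exact: leq_trans (leq_pred _).
Qed.

Lemma boundedX s n (a : A) : (0 < s)%N -> bounded s a ->
  bounded (n * s).+1 (a ^+ n).
Proof.
move=> s0 sa; elim: n => [|n IH]; first exact: bounded1.
by rewrite exprS mulSn -addnS; apply: boundedM.
Qed.

Lemma bounded_prod s n (f : 'I_n -> A) : (0 < s)%N ->
  (forall i, bounded s (f i)) -> bounded (n * s).+1 (\prod_i f i).
Proof.
move=> s0; elim: n f => [|n IH] f sf; first by rewrite big_ord0; apply: bounded1.
by rewrite big_ord_recl mulSn -addnS; apply: boundedM => //; apply: IH => i.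
Qed.

Lemma bounded_span s (a : A) : bounded s a ->
  exists b : idx * 'X_{1..d < s} -> F, a =
  \sum_t cst (b t) * (inj 'X_[(t.2 : 'X_{1..d})] * bas wvar t.1).
Proof.
move=> /choice[p pP].
exists (fun t : idx * 'X_{1..d < s} => (p t.1)@_(t.2 : 'X_{1..d})).
rewrite [LHS]ext_basis -(pair_bigA _ (fun k (m : 'X_{1..d < s}) =>
   cst ((p k)@_(m : 'X_{1..d})) * (inj 'X_[(m : 'X_{1..d})] * bas wvar k))).
apply: eq_bigr => k _; have [-> sp] := pP k.
rewrite {1}(mpolywE sp) -[inc wvar _]/(inj _) rmorph_sum mulr_suml.
apply: eq_bigr => m _.
by rewrite mulrA cstE -rmorphM mul_mpolyC.
Qed.

Lemma card_bmultinom_le b : (#|{: 'X_{1..d < b}}| <= b ^ d)%N.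
Proof.
rewrite -[X in (_ <= _ ^ X)%N]card_ord -[X in (_ <= X ^ _)%N]card_ord -card_ffun.
have lt (m : 'X_{1..d < b}) i : (m i < b)%N.
  exact: leq_ltn_trans (leq_mnm_mdeg _ _) (bmdeg m).
pose f (m : 'X_{1..d < b}) := [ffun i : 'I_d => Ordinal (lt m i)].
apply: (@leq_card _ _ f) => m m' /ffunP ff; apply/val_inj/mnmP => i.
by have := ff i; rewrite !ffunE => /(congr1 val).
Qed.

(** With cleared denominators, the monomials of exponents less than [N] have
  polynomial components of degree [O(N)], in a space of dimension [O(N ^ d)]. *)
Lemma ext_growth : growth_le cst #|{: idx}| d.
Proof.
move=> x.
have /choice[q qP] (i : 'I_d.+1) : exists q : poly, q@_0%MM != 0 /\
    exists s, bounded s (inj q * x i).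
  have [q [p [q0 qx]]] := common_denominator (x i); exists q; split=> //.
  exists (\max_k msize (p k)) => k; exists (p k).
  by rewrite injME qx; split=> //; apply: leq_bigmax.
have /choice[s sP] i : exists s, bounded s (inj (q i) * x i) by case: (qP i).
have /choice[v vP] i : exists v, inj (q i) * v = 1.
  by apply: inj_unit; case: (qP i).
pose t := (\max_i s i).+1.
have tP i : bounded t (inj (q i) * x i).
  by apply: boundedW (sP i); rewrite leqW// leq_bigmax.
exists (fun i => inj (q i)), v, (d.+1 * t.+1).+1; split=> // N.
exists (idx * 'X_{1..d < (d.+1 * t.+1).+1 * N})%type.
exists (fun b : idx * 'X_{1..d < (d.+1 * t.+1).+1 * N} =>
  inj 'X_[(b.2 : 'X_{1..d})] * bas wvar b.1); split.
  by rewrite card_prod leq_mul2l card_bmultinom_le orbT.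
move=> m; apply: bounded_span.
have N0 : (0 < N)%N by apply: leq_ltn_trans (ltn_ord (m ord0)).
apply: (@boundedW (d.+1 * (N * t).+1).+1).
  by have : (d.+1 <= d.+1 * N)%N; [rewrite leq_pmulr | nia].
apply: bounded_prod => // i; apply: (@boundedW (m i * t).+1).
  by rewrite ltnS leq_mul2r (ltnW (ltn_ord (m i))) orbT.
exact: boundedX.
Qed.

(** ** Prime ideals and the regular sequence *)

Definition vars j : {pred 'X_{1..d}} :=
  [pred m : 'X_{1..d} | [exists i : 'I_d, (i < j)%N && (m i != 0%N)]].

Lemma vars_upclosed j : upclosed (vars j).
Proof.
move=> m m' /existsP[i /andP[ij mi]]; apply/existsP; exists i.
by rewrite ij mnmDE addn_eq0 negb_and mi.
Qed.

Lemma vars_prime j m m' : (m + m')%MM \in vars j ->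
  m \in vars j \/ m' \in vars j.
Proof.
case/existsP=> i /andP[ij]; rewrite mnmDE addn_eq0 negb_and => /orP[mi|mi].
  by left; apply/existsP; exists i; rewrite ij.
by right; apply/existsP; exists i; rewrite ij.
Qed.

Lemma mem_varsU j (i : 'I_d) : (U_(i)%MM \in vars j) = (i < j)%N.
Proof.
apply/existsP/idP => [[l /andP[lj]]|ij].
  by rewrite mnm1E; case: (eqVneq i l) => // ->.
by exists i; rewrite ij mnm1E eqxx.
Qed.

Lemma vars0 j : (0%MM \in vars j) = false.
Proof. by apply/negbTE/existsPn => i; rewrite mnm0E andbF. Qed.

Lemma vars_not1 j : ~ monideal (vars j) (1 : loc F d).
Proof.
by rewrite -emb1 -mpolyX0 => /monidealX => /(_ (@vars_upclosed j)); rewrite vars0.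
Qed.

Definition prime_id j : set A := [set a | monideal (vars j) (a None)].

Lemma prime_idP j : prime_ideal (prime_id j).
Proof.
have iN := @monideal_ideal F d _ (@vars_upclosed j).
apply/prime_idealP; split.
- apply/idealP; split=> [|a b|b a]; rewrite /prime_id /= ?mulNE ?ffunE.
  + exact: ideal0.
  + exact: idealD.
  exact: idealMl.
- by rewrite /prime_id /= oneE; apply: vars_not1.
move=> a b; rewrite /prime_id /= mulNE.
by apply: monideal_prime; [apply: vars_upclosed|apply: vars_prime].
Qed.

Lemma prime_id_chain : strict_chain (@prime_ideal A) prime_id d.
Proof.
split=> [i _|j ltjd]; first exact: prime_idP.
split=> [a|/(_ (inj 'X_(Ordinal ltjd)))].
  apply: monideal_sub => m /existsP[i /andP[ij mi]]; apply/existsP; exists i.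
  by rewrite mi ltnW.
rewrite /prime_id /mkset injE => sub.
have : monideal (vars j) (emb 'X_[F, U_(Ordinal ltjd)]).
  by apply: sub; apply/(monidealX _ _ (@vars_upclosed _)); rewrite mem_varsU /=.
by move/(monidealX _ _ (@vars_upclosed _)); rewrite mem_varsU /= ltnn.
Qed.

Lemma ext_krull_dim : krull_dim A d.
Proof.
split; first by exists prime_id; apply: prime_id_chain.
by move=> K n; apply: growth_prime_chain ext_growth.
Qed.

Lemma nth_zs (j : 'I_d) : zs`_j = inj 'X_j.
Proof. by rewrite -tnth_nth tnth_mktuple. Qed.

Lemma mem_take_zs j x : x \in take j zs <->
  exists i : 'I_d, (i < j)%N /\ x = inj 'X_i.
Proof.
split=> [/(nthP 0)[i]|[i [ij ->]]].
  rewrite size_take size_tuple => lti.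
  have [ltij ltid] : (i < j)%N /\ (i < d)%N by split; move: lti; case: ifP; lia.
  by rewrite nth_take// => <-; exists (Ordinal ltid); rewrite -nth_zs.
apply/(nthP 0); exists i; last by rewrite nth_take// nth_zs.
by rewrite size_take size_tuple; case: ifP.
Qed.

Lemma generated_take_zs j : generated (take j zs) = monset (fun=> vars j).
Proof.
have adm : admissible (fun=> vars j).
  split=> [k|k m|i m mj]; [exact: vars_upclosed|by []|].
  by rewrite addmC; apply: vars_upclosed.
have iG := generated_ideal (take j zs).
apply/seteqP; split.
  apply: generated_min; first exact: monset_ideal.
  move=> x /mem_take_zs[i [ij ->]]; rewrite -[inj _]mulr1 -basN.
  by apply: monsetX => [k|]; [apply: vars_upclosed|rewrite mem_varsU].
apply: monset_gen => // k m /existsP[i /andP[ij mi]].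
rewrite (mnm_split_var mi) mpolyXD rmorphM -mulrA; apply: idealMr => //.
by apply: mem_generated; apply/mem_take_zs; exists i.
Qed.

Lemma zs_regular : regular_in maxid zs.
Proof.
split=> [x /zsP[i ->]|].
  rewrite /maxid /mkset injE; apply/(monidealX _ _ (@degge_upclosed d 1)).
  by rewrite inE mdeg1.
split=> [j|]; last first.
  by rewrite -[zs : seq A]take_size generated_take_zs => /(_ None); rewrite oneE;
    apply: vars_not1.
rewrite size_tuple => ltjd x; rewrite generated_take_zs => zx k.
have := zx k; rewrite (nth_zs (Ordinal ltjd)) injME => zxk.
have [|//] := monideal_prime (@vars_upclosed j) (@vars_prime j) zxk.
by move/(monidealX _ _ (@vars_upclosed _)); rewrite mem_varsU /= ltnn.
Qed.

Lemma ext_CohenMacaulay : CohenMacaulay_local maxid.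
Proof.
split; [exact: ext_noetherian|exact: maxid_local|].
exists d; split; first exact: ext_krull_dim.
split=> [|s [_ regs]]; last exact: growth_regular ext_growth regs.
by exists zs; split; [exact: zs_regular|rewrite size_tuple].
Qed.

End Example.

Theorem theorem5p1 (c d : nat) (c_gt0 : (0 < c)%N) (le_cd : (c <= d)%N) :
  exists (A : comNzRingType) (m : set A),
    [/\ CohenMacaulay_local m, infinite_set (cosets m) &
      exists I : set A,
        [/\ primary_to m I,
            krull_dim A d,
            exists (e : nat -> int) (l : nat),
              [/\ hilbert_coefficients d I e,
                  quot_length setT I l &
                  e 1%N = e 0%N - l%:Z + 1]
          & exists a : d.-tuple A,
              reduction (generated a) I /\
              quot_length (ideal_exp I 2) (ideal_mul (generated a) I) c]].
Proof.
exists (ext (wvar rat le_cd)), (@maxid rat c d le_cd); split.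
- exact: ext_CohenMacaulay.
- exact: maxid_cosets.
exists (@idI rat c d le_cd); split.
- exact: idI_primary.
- exact: ext_krull_dim.
- exists (hcoef c), 2%N; split; first exact: hilbert_idI.
    exact: length_A_idI.
  by rewrite /hcoef /=; lia.
exists (@zs rat c d le_cd); split; first exact: zs_reduction.
exact: length_idI2.
Qed.
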